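(* Let $\bar X=(\bar X_t)_{t\ge 0}$, $\bar Y=(\bar Y_t)_{t\ge 0}$ and $\bar Z=(\bar Z_t)_{t\ge 0}$ be (possibly time-inhomogeneous) Markov chains with time indexed by $t=0,1,2,\dots$ and countable state spaces $A$, $B$ and $C$ respectively. Suppose that for maps $f:A\to C$ and $g:B\to C$, $$\bigl(f(\bar X_t)\bigr)_{t\ge 0}\overset{d}{=}\bar Z\overset{d}{=}\bigl(g(\bar Y_t)\bigr)_{t\ge 0}.$$ Then there exists a (not necessarily homogeneous) Markov chain $(X_t,Y_t)_{t\ge 0}$ such that $(X_t)_{t\ge0}\overset{d}{=}\bar X$, $(Y_t)_{t\ge0}\overset{d}{=}\bar Y$, and $f(X_t)=g(Y_t)$ for all $t\ge 0$. Moreover, writing $Z_t=f(X_t)=g(Y_t)$, the chain $(X_t,Y_t)_{t\ge0}$ may be chosen so that, in addition, the processes $X=(X_t)_{t\ge 0}$ and $Y=(Y_t)_{t\ge 0}$ are conditionally independent given the process $Z=(Z_t)_{t\ge 0}$.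
   Context: A Markov chain is regarded as a stochastic process with a specified initial distribution as well as its (possibly time-dependent) transition matrices; $\overset{d}{=}$ denotes equality in law of processes. State spaces of Markov chains are always countable. *)

(* Defs.v *)
From HB Require Import structures.
From mathcomp Require Import all_boot all_order all_algebra.
From mathcomp Require Import all_classical all_reals all_analysis.

Set Implicit Arguments.
Unset Strict Implicit.
Unset Printing Implicit Defensive.

Import Order.TTheory GRing.Theory Num.Theory.
Import numFieldNormedType.Exports.

Local Open Scope classical_set_scope.
Local Open Scope ring_scope.

(* State spaces carry the discrete sigma-algebra; the path space [nat -> S]
   carries the product sigma-algebra, generated by the coordinate maps. *)
Definition path_measurable (S : Type) : set (set (nat -> S)) :=
  <<s \bigcup_t preimage_set_system [set: nat -> S]
        (fun x : nat -> S => x t) discrete_measurable >>.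

Definition trajectory (T S : Type) (X : nat -> T -> S) : T -> nat -> S :=
  fun w t => X t w.

Definition is_process (d : measure_display) (T : measurableType d) (S : Type)
    (X : nat -> T -> S) : Prop :=
  forall (t : nat) (U : set S), measurable (X t @^-1` U).

Definition process_law (d : measure_display) (T : measurableType d)
    (R : realType) (P : probability T R) (S : Type) (X : nat -> T -> S)
    (E : set (nat -> S)) : \bar R :=
  P (trajectory X @^-1` E).

Definition eq_in_law (R : realType) (S : Type)
    (d : measure_display) (T : measurableType d) (P : probability T R)
    (X : nat -> T -> S)
    (d' : measure_display) (T' : measurableType d') (P' : probability T' R)
    (X' : nat -> T' -> S) : Prop :=
  forall E : set (nat -> S), path_measurable E ->
    process_law P X E = process_law P' X' E.

Definition is_distribution (R : realType) (S : countType) (mu : S -> R)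
    : Prop :=
  (forall a, 0 <= mu a) /\ \esum_(a in [set: S]) (mu a)%:E = 1%:E.

Definition stochastic_matrix (R : realType) (S : countType)
    (p : S -> S -> R) : Prop :=
  forall a, is_distribution (p a).

(* Elementary conditional probability; meaningful only when [P F != 0]. *)
Definition cprob (d : measure_display) (T : measurableType d) (R : realType)
    (P : probability T R) (E F : set T) : R :=
  fine (P (E `&` F)) / fine (P F).

Definition history (T S : Type) (X : nat -> T -> S) (x : nat -> S) (t : nat)
    : set T :=
  [set w | forall s : nat, (s <= t)%N -> X s w = x s].

(* [p t a b] is the probability of moving from [a] at time [t] to [b] at time
   [t.+1]. *)
Definition markov_chain (d : measure_display) (T : measurableType d)
    (R : realType) (P : probability T R) (S : countType)
    (mu : S -> R) (p : nat -> S -> S -> R) (X : nat -> T -> S) : Prop :=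
  [/\ is_process X,
      is_distribution mu,
      forall t, stochastic_matrix (p t),
      forall a, P (X 0%N @^-1` [set a]) = (mu a)%:E &
      forall (t : nat) (x : nat -> S) (b : S),
        P (history X x t) != 0%E ->
        cprob P (X t.+1 @^-1` [set b]) (history X x t) = p t (x t) b].

Definition sigma_process (T S : Type) (X : nat -> T -> S) : set (set T) :=
  preimage_set_system [set: T] (trajectory X) (@path_measurable S).

(* [h] is a version of the conditional probability of [E] given the
   sigma-algebra [G]. *)
Definition is_cond_prob (d : measure_display) (T : measurableType d)
    (R : realType) (P : probability T R) (G : set (set T)) (E : set T)
    (h : T -> R) : Prop :=
  [/\ measurable_fun [set: g_sigma_algebraType G]
        (h : g_sigma_algebraType G -> R),
      P.-integrable [set: T] (fun w => (h w)%:E) &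
      forall D : set T, G D -> (\int[P]_(w in D) (h w)%:E = P (E `&` D))%E].

(* Versions of a conditional probability exist and are unique up to null sets;
   asserting their existence here keeps the definition from being vacuous. *)
Definition cond_independent (d : measure_display) (T : measurableType d)
    (R : realType) (P : probability T R) (SX SY SZ : Type)
    (X : nat -> T -> SX) (Y : nat -> T -> SY) (Z : nat -> T -> SZ) : Prop :=
  forall E F : set T, sigma_process X E -> sigma_process Y F ->
    exists hE hF hEF : T -> R,
      [/\ is_cond_prob P (sigma_process Z) E hE,
          is_cond_prob P (sigma_process Z) F hF,
          is_cond_prob P (sigma_process Z) (E `&` F) hEF &
          {ae P, forall w, hEF w = hE w * hF w}].

(* Main.v *)
From HB Require Import structures.
Require Import Defs.
From mathcomp Require Import all_boot all_order all_algebra.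
From mathcomp Require Import all_classical all_reals all_analysis.
From mathcomp Require Import measurable_realfun ring lra.

Set Implicit Arguments.
Unset Strict Implicit.
Unset Printing Implicit Defensive.

Import Order.TTheory GRing.Theory Num.Theory.
Import numFieldNormedType.Exports.

Local Open Scope classical_set_scope.
Local Open Scope ring_scope.

(** The coupling is the conditionally independent one: draw the path [z] of
   the common image process from its law, then draw the paths of the two chains
   independently of each other from their conditional laws given [z]. Conditional
   independence and the two marginal laws hold by construction; two points need
   an argument.

   Existence. Conditional laws given [z] are obtained on cylinders as
   Radon-Nikodym densities. Almost surely they are consistent, so they cut [0, 1[
   into nested families of intervals, a word [s] receiving an interval whose
   length is the conditional probability that the path starts with [s]; a uniform
   variable [u] then follows the unique path whose intervals contain it
   ([conditional_sampling]). With two independent uniform variables the coupling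
   lives on the product of the paths of the image process and of the unit square.
   The identities [f (X t) = z t = g (Y t)] hold there off a null set only, and
   the outcomes of this null set are redirected to one fixed good outcome
   ([conditional_coupling]).

   Markov property of the pair. Let the word [rcons s a] have length [n.+1]. As
   the first chain is Markov, the future after time [n] depends on [rcons s a]
   through [a] only ([past_future]); as the image process is Markov, the law of
   its future after [n] depends on its own past through its present only. Hence
   the conditional probability given [z] that the first chain starts with
   [rcons s a] is
     [past_weight s a / past_weight (map f s) (f a) * h n a (z n, z n.+1, ...)]
   if [z] starts with [map f (rcons s a)], and [0] otherwise, with a density [h]
   that ignores [s] ([lumped_density]). Multiplying by the similar formula for
   the second chain and integrating over [z] shows that the pair starts with the
   words [rcons s a] and [rcons t b] with probability [w * H n a b], where [H]
   only sees the present and the weight [w] is multiplied, when both words grow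
   by one letter, by a factor that only sees the present and the next step
   ([joint_prefix_factor], [joint_weight_rcons]). The ratio of two successive
   such probabilities is a function of [n], of the present and of the next step:
   the pair is Markov. *)

(** * The measurable space of paths *)

(** A copy of [nat -> S] that carries the product sigma-algebra; the state [s0] is
   there because measurable spaces are pointed. *)
Definition paths (S : Type) (s0 : S) : Type := nat -> S.

Section paths_structure.
Context (S : Type) (s0 : S).

HB.instance Definition _ := gen_eqMixin (paths s0).
HB.instance Definition _ := gen_choiceMixin (paths s0).
HB.instance Definition _ := isPointed.Build (paths s0) (fun=> s0).

Let path_measurable0 : @path_measurable S set0.
Proof. exact: sigma_algebra0. Qed.

Let path_measurableC (E : set (paths s0)) :
  @path_measurable S E -> @path_measurable S (~` E).
Proof. by move=> mE; rewrite -setTD; exact: sigma_algebraCD. Qed.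

Let path_measurable_bigcup (F : (set (paths s0))^nat) :
  (forall i, @path_measurable S (F i)) -> @path_measurable S (\bigcup_i F i).
Proof. exact: sigma_algebra_bigcup. Qed.

HB.instance Definition _ := @isMeasurable.Build (sigma_display (@path_measurable S))
  (paths s0) (@path_measurable S)
  path_measurable0 path_measurableC path_measurable_bigcup.

End paths_structure.

Definition cylinder (S : Type) (s0 : S) (s : seq S) : set (paths s0) :=
  [set x | mkseq x (size s) = s].
Arguments cylinder {S} s0 s.

Lemma mkseqS (T : Type) (x : nat -> T) n : mkseq x n.+1 = rcons (mkseq x n) (x n).
Proof. by rewrite /mkseq -addn1 iotaD map_cat /= add0n cats1. Qed.

Lemma mkseq_cons (T : Type) (x : nat -> T) n :
  mkseq x n.+1 = x 0%N :: mkseq (fun i => x i.+1) n.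
Proof. by rewrite /mkseq /= -[1%N]addn0 iotaDl -map_comp. Qed.

Lemma take_mkseq (T : Type) (x : nat -> T) m n : (m <= n)%N ->
  take m (mkseq x n) = mkseq x m.
Proof. by move=> mn; rewrite /mkseq -map_take take_iota (minn_idPl mn). Qed.

Section cylinders.
Context (S : Type) (s0 : S).
Implicit Types (s : seq S) (x : paths s0).

Lemma cylinder_nil : cylinder s0 [::] = [set: paths s0].
Proof. by apply/seteqP; split. Qed.

Lemma cylinder_mkseq x n : cylinder s0 (mkseq x n) x.
Proof. by rewrite /cylinder /= size_mkseq. Qed.

Lemma cylinderP n x s : size s = n -> cylinder s0 s x <-> mkseq x n = s.
Proof. by move=> <-. Qed.

Lemma cylinder_rcons s a :
  cylinder s0 (rcons s a) = cylinder s0 s `&` [set x : paths s0 | x (size s) = a].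
Proof.
apply/seteqP; split=> x; rewrite /cylinder /= size_rcons mkseqS.
  by move=> /rcons_inj[-> ->].
by case=> -> ->.
Qed.

Lemma cylinder_cons s a :
  cylinder s0 (a :: s) =
    [set x : paths s0 | x 0%N = a] `&`
    [set x : paths s0 | cylinder s0 s (fun i => x i.+1)].
Proof.
apply/seteqP; split=> x; rewrite /cylinder /= mkseq_cons.
  by move=> [-> ->].
by case=> -> ->.
Qed.

Lemma history_cylinder (T : Type) (X : nat -> T -> S) x t :
  history X x t = trajectory X @^-1` cylinder s0 (mkseq x t.+1).
Proof.
apply/seteqP; split=> w; last first.
  move=> /(cylinderP _ (size_mkseq _ _)) h i it.
  by have := congr1 (nth (x 0%N) ^~ i) h; rewrite !nth_mkseq.
move=> h; apply/(cylinderP _ (size_mkseq _ _)).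
by apply/eq_in_map => i; rewrite mem_iota => /h.
Qed.

End cylinders.

Section cylinders_generate.
Context (S : countType) (s0 : S).
Implicit Types (s : seq S).

Lemma measurable_coord t (U : set S) : measurable ([set x : paths s0 | U (x t)] : set (paths s0)).
Proof.
apply: sub_sigma_algebra; exists t => //; exists U => //.
by rewrite setTI.
Qed.

Lemma measurable_cylinder s : measurable (cylinder s0 s : set (paths s0)).
Proof.
elim/last_ind: s => [|s a IH]; first by rewrite cylinder_nil; exact: measurableT.
by rewrite cylinder_rcons; apply: measurableI => //; exact: (measurable_coord _ [set a]).
Qed.

(** [set0] is included because two incompatible words have disjoint cylinders. *)
Definition cylinders : set (set (paths s0)) :=
  [set E | E = set0 \/ exists s, E = cylinder s0 s].

(** One of two words is a prefix of the other, or their cylinders are disjoint. *)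
Lemma cylinders_setI : setI_closed cylinders.
Proof.
have main s s' : (size s <= size s')%N -> cylinders (cylinder s0 s `&` cylinder s0 s').
  move=> ss'; have [h|h] := pselect (take (size s) s' = s).
    right; exists s'; apply/seteqP; split=> [x [_ //]|x xs']; split=> //.
    by rewrite /cylinder /= -[RHS]h -xs' take_mkseq.
  left; apply/seteqP; split=> // x [xs xs']; apply: h.
  by rewrite -xs' take_mkseq.
move=> _ _ [->|[s ->]] [->|[s' ->]]; rewrite ?set0I ?setI0; try by left.
case: (leqP (size s) (size s')) => [|/ltnW]; first exact: main.
by rewrite setIC; exact: main.
Qed.

Lemma coord_cylinders t (U : set S) : [set x : paths s0 | U (x t)] =
  \bigcup_(s in [set s | size s = t.+1 /\ U (nth s0 s t)]) cylinder s0 s.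
Proof.
apply/seteqP; split=> x /=.
  move=> Ux; exists (mkseq x t.+1); last exact: cylinder_mkseq.
  by split; [exact: size_mkseq|rewrite nth_mkseq].
by move=> [s /= [st Us]] /(cylinderP _ st) h; move: Us; rewrite -h nth_mkseq.
Qed.

(** There are countably many words, so an event about one coordinate is a
   countable union of cylinders. *)
Lemma sigma_cylinders : (measurable : set (set (paths s0))) = <<s cylinders >>.
Proof.
apply/seteqP; split.
  apply: smallest_sub; first exact: smallest_sigma_algebra.
  move=> _ [t _ [U _ <-]]; rewrite setTI.
  have -> : (fun x : paths s0 => x t) @^-1` U = [set x : paths s0 | U (x t)] by [].
  rewrite coord_cylinders bigcup_mkcond.
  pose GT := @g_sigma_algebraType (paths s0) cylinders.
  apply: (@countable_bigcupT_measurable _ GT).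
    exact: countableP.
  move=> s; case: ifPn => _; last exact: (@measurable0 _ GT).
  by apply: sub_sigma_algebra; right; exists s.
apply: smallest_sub; first exact: (@sigma_algebra_measurable _ (paths s0)).
move=> _ [->|[s ->]]; first exact: measurable0.
exact: measurable_cylinder.
Qed.

Lemma measurable_fun_paths d (T : measurableType d) (X : T -> paths s0) :
  (forall s, measurable (X @^-1` cylinder s0 s)) -> measurable_fun [set: T] X.
Proof.
move=> mX; apply: (measurability cylinders); first exact: sigma_cylinders.
move=> _ [_ [->|[s ->]] <-]; rewrite setTI; last exact: mX.
by rewrite preimage_set0; exact: measurable0.
Qed.

Lemma measurable_fun_coords d (T : measurableType d) (X : T -> paths s0) :
  (forall t a, measurable [set w | X w t = a]) -> measurable_fun [set: T] X.
Proof.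
move=> mX; apply: measurable_fun_paths; elim/last_ind => [|s a IH].
  by rewrite cylinder_nil preimage_setT; exact: measurableT.
rewrite cylinder_rcons preimage_setI; apply: measurableI => //; exact: mX.
Qed.

(** Cylinders form a pi-system, so they determine finite measures. *)
Lemma paths_measure_unique (R : realType) (m1 m2 : {measure set (paths s0) -> \bar R}) :
  (m1 setT < +oo)%E -> (forall s, m1 (cylinder s0 s) = m2 (cylinder s0 s)) ->
  forall E, measurable E -> m1 E = m2 E.
Proof.
move=> m1oo m12 E; apply: (measure_unique cylinders (fun=> setT)) => //.
- exact: sigma_cylinders.
- exact: cylinders_setI.
- by move=> _; right; exists [::]; rewrite cylinder_nil.
- by rewrite bigcup_const.
- by move=> _ [->|[s ->]]; rewrite ?measure0.
Qed.

End cylinders_generate.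

Lemma measurable_trajectory (S : countType) (s0 : S) d (T : measurableType d)
    (X : nat -> T -> S) : is_process X ->
  measurable_fun [set: T] (trajectory X : T -> paths s0).
Proof. by move=> pX; apply: measurable_fun_coords => t a; exact: (pX t [set a]). Qed.

Section map_paths.
Context (S S' : countType) (s0 : S) (s0' : S') (f : S -> S').

Definition map_paths (x : paths s0) : paths s0' := fun t => f (x t).

Lemma measurable_map_paths : measurable_fun [set: paths s0] map_paths.
Proof.
by apply: measurable_fun_coords => t a; exact: (measurable_coord s0 _ (f @^-1` [set a])).
Qed.

End map_paths.

Section path_shift.
Context (S : countType) (s0 : S).

Definition path_shift (n : nat) (x : paths s0) : paths s0 := fun i => x (n + i)%N.

Lemma measurable_path_shift n : measurable_fun [set: paths s0] (path_shift n).
Proof. by apply: measurable_fun_coords => t a; exact: (measurable_coord s0 _ [set a]). Qed.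

End path_shift.

(** * Images of measures, densities and the Markov property of a law on paths *)

Definition image_on d d' (T : measurableType d) (U : measurableType d')
    (R : realType) (m : set T -> \bar R) (D : set T) (X : T -> U)
    & measurable D & measurable_fun [set: T] X :=
  fun E : set U => m (D `&` X @^-1` E).

Section image_on.
Context d d' (T : measurableType d) (U : measurableType d') (R : realType).
Context (m : {finite_measure set T -> \bar R}) (D : set T) (mD : measurable D).
Context (X : T -> U) (mX : measurable_fun [set: T] X).

Local Notation image := (image_on m mD mX).

Lemma measurable_preimage_in E : measurable E -> measurable (X @^-1` E).
Proof. by move=> mE; rewrite -[X in measurable X]setTI; exact: mX. Qed.

Let image0 : image set0 = 0%E.
Proof. by rewrite /image_on preimage_set0 setI0 measure0. Qed.

Let image_ge0 E : (0 <= image E)%E.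
Proof. exact: measure_ge0. Qed.

Let image_sigma_additive : semi_sigma_additive image.
Proof.
move=> F mF tF mUF; rewrite /image_on preimage_bigcup setI_bigcupr.
have mDF i : measurable (D `&` X @^-1` F i).
  by apply: measurableI => //; exact: measurable_preimage_in.
apply: measure_semi_sigma_additive => //; last exact: bigcupT_measurable.
apply/trivIsetP => i j _ _ ij; rewrite setIACA setIid -preimage_setI.
by move/trivIsetP : tF => /(_ _ _ _ _ ij) ->//; rewrite preimage_set0 setI0.
Qed.

HB.instance Definition _ := isMeasure.Build _ _ _ image
  image0 image_ge0 image_sigma_additive.

Let image_fin : fin_num_fun image.
Proof.
move=> E mE; apply: fin_num_measure; apply: measurableI => //.
exact: measurable_preimage_in.
Qed.

HB.instance Definition _ := @Measure_isFinite.Build _ U _ image image_fin.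

End image_on.

(** The measure [m] is the sum of its restrictions to [D] and to the complement,
   and the latter does not charge [D]. *)
Lemma integral_mrestr d (T : measurableType d) (R : realType)
    (m : {measure set T -> \bar R}) (D E : set T) (mD : measurable D) (h : T -> \bar R) :
  measurable E -> measurable_fun [set: T] h -> (forall x, 0 <= h x)%E ->
  (\int[mrestr m mD]_(x in E) h x = \int[m]_(x in D `&` E) h x)%E.
Proof.
move=> mE mh h0.
have mDE : measurable (D `&` E) by exact: measurableI.
transitivity (\int[mrestr m mD]_(x in D `&` E) h x)%E.
  rewrite -{1}[E](setUIDK _ D) setIC ge0_integral_setU//=; first last.
  - rewrite disj_set2E; apply/eqP/seteqP; split=> // x [] [? ?] [? ?]; tauto.
  - exact: measurable_funTS.
  - exact: measurableD.
  rewrite [X in (_ + X)%E](_ : _ = \int[mzero]_(x in E `\` D) h x)%E; last first.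
    apply: eq_measure_integral => A mA AED; rewrite /= /mrestr.
    rewrite (_ : A `&` D = set0) ?measure0//.
    by apply/seteqP; split=> // x [/AED [_ ]] nD /nD.
  by rewrite integral_measure_zero adde0.
apply: eq_measure_integral => A mA AD; rewrite /= /mrestr (setIidl (B := D))//.
by move=> x /AD[].
Qed.

Lemma integral_image_on d d' (T : measurableType d) (U : measurableType d') (R : realType)
    (m : {finite_measure set T -> \bar R}) (D : set T) (mD : measurable D)
    (X : T -> U) (mX : measurable_fun [set: T] X) (E : set U) (h : U -> \bar R) :
  measurable E -> measurable_fun [set: U] h -> (forall x, 0 <= h x)%E ->
  (\int[image_on m mD mX]_(x in E) h x = \int[m]_(x in D `&` X @^-1` E) h (X x))%E.
Proof.
move=> mE mh h0; rewrite -(integral_mrestr _ mD); first last.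
- by move=> x; exact: h0.
- exact: measurableT_comp.
- exact: measurable_preimage_in.
rewrite -(@ge0_integral_pushforward _ _ _ _ _ _ mX _ E h)//; last exact: measurable_funTS.
by apply: eq_measure_integral => A mA _; rewrite /= /image_on /pushforward /mrestr setIC.
Qed.

Lemma density_exists d (T : measurableType d) (R : realType)
    (nu mu : {finite_measure set T -> \bar R}) :
  (forall E, measurable E -> nu E <= mu E)%E ->
  exists h : T -> \bar R, [/\ measurable_fun [set: T] h,
    (forall x, 0 <= h x)%E, (forall x, h x \is a fin_num) &
    forall E, measurable E -> nu E = (\int[mu]_(x in E) h x)%E].
Proof.
move=> numu.
have dom : nu `<< mu.
  apply/null_content_dominatesP => E mE muE0; apply/eqP.
  by rewrite eq_le measure_ge0 andbT -muE0 numu.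
exists (Radon_Nikodym_SigmaFinite.f nu mu); split.
- exact: measurable_int (Radon_Nikodym_SigmaFinite.f_integrable dom).
- exact: Radon_Nikodym_SigmaFinite.f_ge0.
- exact: Radon_Nikodym_SigmaFinite.f_fin_num.
- exact: Radon_Nikodym_SigmaFinite.f_integral.
Qed.

Lemma measure_fibers d (T : measurableType d) (R : realType)
    (m : {measure set T -> \bar R}) (I : countType) (h : T -> I) (E : set T) :
  measurable E -> (forall i, measurable [set w | h w = i]) ->
  m E = \esum_(i in [set: I]) m (E `&` [set w | h w = i]).
Proof.
move=> mE mh; pose F n := E `&` [set w | pickle (h w) = n].
have FE i : F (pickle i) = E `&` [set w | h w = i].
  apply/seteqP; split=> w [Ew hw]; split=> //=; last by rewrite hw.
  exact: (pcan_inj pickleK).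
have EF : E = \bigcup_(n in pickle @` [set: I]) F n.
  apply/seteqP; split=> [w Ew|w [n _ []//]].
  by exists (pickle (h w)); [exists (h w)|].
rewrite [in LHS]EF (measure_bigcup m); first last.
- by move=> i j _ _ [w [[_ hi] [_ hj]]]; rewrite -hi -hj.
- by move=> _ [i _ <-]; rewrite FE; exact: measurableI.
rewrite nneseries_esum// set_mem_set esum_image; last first.
  by move=> i j _ _ /(pcan_inj pickleK).
by apply: eq_esum => i _; rewrite FE.
Qed.

(** Proportionality on every fiber of a countably valued map, with one common
   factor, adds up; this is how a coordinate is integrated out. *)
Lemma measure_fibers_scale d (T : measurableType d) (R : realType)
    (m : {measure set T -> \bar R}) (I : countType) (h : T -> I) (E F : set T) (r : R) :
  measurable E -> measurable F -> (forall i, measurable [set w | h w = i]) -> 0 <= r ->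
  (forall i, m (F `&` [set w | h w = i]) = m (E `&` [set w | h w = i]) * r%:E)%E ->
  m F = (m E * r%:E)%E.
Proof.
move=> mE mF mh r0 EF; have EE : (r%:E * m E)%E =
    \esum_(i in [set: I]) (r%:E * m (E `&` [set w | h w = i]))%E.
  exact: (measure_fibers (mscale (NngNum r0) m) mE mh).
rewrite (measure_fibers m mF mh) muleC EE.
by apply: eq_esum => i _; rewrite EF muleC.
Qed.


(** Dividing by [c] is harmless even if [c = 0], since then [x = 0] too. *)
Lemma eq_divr_mule (R : realType) (x y c d : \bar R) :
  x \is a fin_num -> y \is a fin_num -> c \is a fin_num -> d \is a fin_num ->
  (0 <= x <= c)%E -> (x * c = y * d)%E -> x = ((fine d / fine c)%:E * y)%E.
Proof.
move: x y c d => [x| |] [y| |] [c| |] [d| |] //= _ _ _ _.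
rewrite !lee_fin -!EFinM => /andP[x0 xc] [xcyd]; congr (_%:E).
have [c0|c0] := eqVneq c 0; last by rewrite mulrAC [d * y]mulrC -xcyd mulfK.
by rewrite c0 invr0 mulr0 mul0r; apply/eqP; rewrite eq_le x0 -c0 xc.
Qed.

(** The Markov property of a law on paths, in multiplicative form: no
   conditional probability, hence no case distinction on null histories. *)
Definition markov_law (R : realType) (S : Type) (s0 : S)
    (m : set (paths s0) -> \bar R) (p : nat -> S -> S -> R) : Prop :=
  forall s a b, m (cylinder s0 (rcons (rcons s a) b)) =
    (m (cylinder s0 (rcons s a)) * (p (size s) a b)%:E)%E.

Section past_future.
Context (R : realType) (S : countType) (s0 : S).
Context (m : {finite_measure set (paths s0) -> \bar R}) (p : nat -> S -> S -> R).
Hypothesis p0 : forall t a b, 0 <= p t a b.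
Hypothesis markov : markov_law m p.

Implicit Types (s : seq S) (k : nat).
Local Notation sh := (@path_shift S s0).

Let measurable_shift_cylinder k s : measurable (sh k @^-1` cylinder s0 s : set (paths s0)).
Proof.
rewrite -[X in measurable X]setTI; apply: measurable_path_shift => //.
exact: measurable_cylinder.
Qed.

Lemma shift_cylinder_cons k s a :
  sh k.+1 @^-1` cylinder s0 s `&` [set x : paths s0 | x k = a] =
  sh k @^-1` cylinder s0 (a :: s).
Proof.
rewrite cylinder_cons preimage_setI setIC.
have -> : sh k @^-1` [set x : paths s0 | x 0%N = a] = [set x : paths s0 | x k = a].
  by apply/seteqP; split=> x; rewrite /path_shift /= addn0.
have -> // : sh k.+1 =
    (fun x => (fun y : nat -> S => fun i => y i.+1) (sh k x)).
by apply/funext => x; apply/funext => i; rewrite /path_shift addSnnS.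
Qed.

(** The Markov property for a window that starts at time [k]: the states before [k]
   are summed out one at a time. *)
Lemma shift_markov k s a b :
  m (sh k @^-1` cylinder s0 (rcons (rcons s a) b)) =
  (m (sh k @^-1` cylinder s0 (rcons s a)) * (p (k + size s) a b)%:E)%E.
Proof.
elim: k s => [|k IH] s; first exact: markov.
apply: (@measure_fibers_scale _ _ _ m _ (fun x : paths s0 => x k)) => // [i|c].
  exact: (measurable_coord s0 _ [set i]).
rewrite !shift_cylinder_cons -!rcons_cons; apply: etrans (IH (c :: s)) _.
by rewrite /= addSnnS.
Qed.

Lemma cylinder_cat s u :
  cylinder s0 (s ++ u) = cylinder s0 s `&` sh (size s) @^-1` cylinder s0 u :> set (paths s0).
Proof.
elim/last_ind: u => [|u a IH].
  by rewrite cats0 cylinder_nil preimage_setT setIT.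
rewrite -rcons_cat !cylinder_rcons IH preimage_setI setIA.
by congr (_ `&` _); apply/seteqP; split=> x; rewrite /path_shift /= size_cat.
Qed.

Lemma cylinder_last n a : sh n @^-1` cylinder s0 [:: a] = [set x : paths s0 | x n = a].
Proof.
rewrite -shift_cylinder_cons cylinder_nil preimage_setT setTI //.
Qed.

(** Lengthening [u] by one letter multiplies both sides by the same transition
   probability. *)
Lemma past_future_cylinder s a u :
  (m (cylinder s0 (s ++ a :: u)) * m [set x : paths s0 | x (size s) = a] =
   m (sh (size s) @^-1` cylinder s0 (a :: u)) * m (cylinder s0 (rcons s a)))%E.
Proof.
elim/last_ind: u => [|u b IH]; first by rewrite cats1 cylinder_last muleC.
rewrite -rcons_cons -rcons_cat lastI -rcons_cat markov shift_markov.
by rewrite size_cat rcons_cat -lastI muleAC IH muleAC.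
Qed.

(** The conditional probability of the past [s] given a visit to [a] at time
   [size s]; it is [0] when this visit is a null event. *)
Definition past_weight s a : R :=
  fine (m (cylinder s0 (rcons s a))) / fine (m [set x : paths s0 | x (size s) = a]).

Lemma past_weight_ge0 s a : 0 <= past_weight s a.
Proof. by rewrite divr_ge0 ?fine_ge0. Qed.

Let measurable_at n a : measurable ([set x : paths s0 | x n = a] : set (paths s0)).
Proof. exact: (measurable_coord s0 _ [set a]). Qed.

Let fin E : measurable E -> m E \is a fin_num.
Proof. exact: fin_num_measure. Qed.

Lemma past_weightE s a :
  m (cylinder s0 (rcons s a)) = ((past_weight s a)%:E * m [set x : paths s0 | x (size s) = a])%E.
Proof.
have le : (m (cylinder s0 (rcons s a)) <= m [set x : paths s0 | x (size s) = a])%E.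
  rewrite le_measure ?inE //; first exact: measurable_cylinder.
  by rewrite cylinder_rcons.
apply: eq_divr_mule; rewrite ?le ?measure_ge0 ?fin //; first exact: measurable_cylinder.
  exact: measurable_cylinder.
by rewrite muleC.
Qed.

(** Given the present state [a], the past [s] and the future are independent. Both
   sides are measures in [E], and they agree on cylinders. *)
Lemma past_future s a E : measurable E ->
  (m (cylinder s0 (rcons s a) `&` sh (size s) @^-1` E) =
   (past_weight s a)%:E *
      m ([set x : paths s0 | x (size s) = a]%classic `&` sh (size s) @^-1` E))%E.
Proof.
pose m1 := image_on m (measurable_cylinder s0 (rcons s a)) (@measurable_path_shift S s0 (size s)).
pose m2 := image_on m (measurable_at (size s) a) (@measurable_path_shift S s0 (size s)).
apply: (@paths_measure_unique S s0 R m1 (mscale (NngNum (past_weight_ge0 s a)) m2)).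
  by rewrite -ge0_fin_numE //; exact: fin_num_measure.
move=> u; rewrite /= /mscale /= /m1 /m2 /image_on.
have E1 : cylinder s0 (rcons s a) =
    cylinder s0 s `&` sh (size s) @^-1` cylinder s0 [:: a] :> set (paths s0).
  by rewrite -cylinder_cat cats1.
have E2 : [set x : paths s0 | x (size s) = a] = sh (size s) @^-1` cylinder s0 [:: a].
  by rewrite cylinder_last.
case: u => [|b u].
  by rewrite cylinder_nil preimage_setT !setIT past_weightE.
have [<-|ba] := eqVneq a b; last first.
  have e0 : sh (size s) @^-1` cylinder s0 [:: a] `&` sh (size s) @^-1` cylinder s0 (b :: u)
      = set0 :> set (paths s0).
    rewrite -preimage_setI; apply/seteqP; split=> // x [].
    rewrite !cylinder_cons /= => -[-> _] [/esym ab _].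
    by rewrite ab eqxx in ba.
  by rewrite E1 E2 -setIA e0 setI0 !measure0 mule0.
have e1 : sh (size s) @^-1` cylinder s0 [:: a] `&` sh (size s) @^-1` cylinder s0 (a :: u)
      = sh (size s) @^-1` cylinder s0 (a :: u) :> set (paths s0).
  rewrite -preimage_setI; apply: congr1; apply/seteqP; split=> x.
    by case.
  by rewrite !cylinder_cons /= => -[xa xu]; split=> //; rewrite cylinder_nil.
have mt : measurable (sh (size s) @^-1` cylinder s0 (a :: u) : set (paths s0)).
  exact: measurable_shift_cylinder.
have mc : measurable (cylinder s0 (s ++ a :: u) : set (paths s0)) by exact: measurable_cylinder.
have := past_future_cylinder s a u.
rewrite E1 E2 -setIA e1 -cylinder_cat -E2.
have le : (m (cylinder s0 (s ++ a :: u)) <= m [set x : paths s0 | x (size s) = a])%E.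
  apply: le_measure; rewrite ?inE // => x.
  rewrite cylinder_cat cylinder_cons => -[_ []].
  by rewrite /path_shift /= addn0.
move=> h; have c1 := cylinder_cat s (a :: u).
have c2 : cylinder s0 (rcons s a) = cylinder s0 (s ++ [:: a]) by rewrite cats1.
have mc' : measurable (cylinder s0 (rcons s a)) by exact: measurable_cylinder.
by apply: eq_divr_mule; rewrite -?c1 ?le ?measure_ge0 ?fin // c2.
Qed.

End past_future.

(** * Sampling a path from nested intervals *)

Section nested_intervals.
Context (R : realType) (q : seq nat -> R).

(** The children of the interval of a word are laid side by side in the order of
   their last letters: [cumul s k] is the total length of those before [k]. *)
Definition cumul (s : seq nat) (k : nat) : R := \sum_(j < k) q (rcons s j).

Definition left_end (s : seq nat) : R :=
  \sum_(i < size s) cumul (take i s) (nth 0%N s i).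

(** The child interval that contains the point at distance [v] from the left end
   of the interval of [s]; the default [0] only serves points outside it. *)
Definition pick_child (s : seq nat) (v : R) : nat :=
  xget 0%N [set k | v < cumul s k.+1 /\ forall j, (j < k)%N -> cumul s j.+1 <= v].

Fixpoint word (u : R) (n : nat) : seq nat :=
  if n is n'.+1 then
    rcons (word u n') (pick_child (word u n') (u - left_end (word u n')))
  else [::].

(** For [u] in [0, 1[ and consistent lengths, the path whose intervals all
   contain [u]. *)
Definition itinerary (u : R) : paths 0%N :=
  fun n => pick_child (word u n) (u - left_end (word u n)).

Lemma mkseq_itinerary u n : mkseq (itinerary u) n = word u n.
Proof. by elim: n => // n IH; rewrite mkseqS IH. Qed.

Lemma left_end_rcons s k : left_end (rcons s k) = left_end s + cumul s k.
Proof.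
rewrite /left_end size_rcons big_ord_recr /= nth_rcons ltnn eqxx -cats1.
rewrite take_cat ltnn subnn take0 cats0; congr (_ + _).
by apply: eq_bigr => i _; rewrite take_cat nth_cat ltn_ord.
Qed.

Lemma cumulS s k : cumul s k.+1 = cumul s k + q (rcons s k).
Proof. by rewrite /cumul big_ord_recr. Qed.

Lemma pick_childP s v k : pick_child s v = k <->
  (v < cumul s k.+1 /\ forall j, (j < k)%N -> cumul s j.+1 <= v) \/
  (k = 0%N /\ forall i, cumul s i.+1 <= v).
Proof.
rewrite /pick_child; case: xgetP => [i _ [vi ivj]|nP]; split.
- by move=> <-; left.
- case=> [[vk kvj]|[_ vle]]; last by have := vle i; rewrite leNgt vi.
  case: (ltngtP i k) => // [/kvj|/ivj]; first by rewrite leNgt vi.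
  by rewrite leNgt vk.
- move=> <-; right; split=> // i; elim/ltn_ind: i => i IH.
  by rewrite leNgt; apply/negP => vi; apply: (nP i); split.
- by case=> [/nP//|[-> _]].
Qed.

Hypothesis q_nil : q [::] = 1.
Hypothesis q_ge0 : forall s, 0 <= q s.
Hypothesis q_sum : forall s, (\sum_(k <oo) (q (rcons s k))%:E = (q s)%:E)%E.

Lemma cumul_ge0 s k : 0 <= cumul s k.
Proof. by apply: sumr_ge0. Qed.

Lemma cumul_le s k : cumul s k <= q s.
Proof.
rewrite -lee_fin -q_sum /cumul -sumEFin -(big_mkord xpredT (fun j => (q (rcons s j))%:E)).
by apply: nneseries_lim_ge => i _; rewrite lee_fin.
Qed.

Lemma cumul_exceeds s v : v < q s -> exists k, v < cumul s k.+1.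
Proof.
move=> vq; apply: contrapT => /forallNP h; move: vq; apply/negP; rewrite -leNgt.
rewrite -lee_fin -q_sum; apply: lime_le.
  by apply: is_cvg_nneseries => i _; rewrite lee_fin.
apply: nearW => n; rewrite big_mkord sumEFin lee_fin.
apply: (@le_trans _ _ (cumul s n.+1)); first by rewrite cumulS lerDl.
by rewrite leNgt; apply/negP/h.
Qed.

Lemma le_cumul s j k : (j <= k)%N -> cumul s j <= cumul s k.
Proof.
elim: k => [|k IH]; first by rewrite leqn0 => /eqP ->.
rewrite leq_eqVlt => /orP[/eqP -> //|]; rewrite ltnS => /IH/le_trans; apply.
by rewrite cumulS lerDl.
Qed.

Lemma left_end_bounds s : 0 <= left_end s /\ left_end s + q s <= 1.
Proof.
elim/last_ind: s => [|s k [IH0 IH1]]; first by rewrite /left_end big_ord0 q_nil add0r.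
rewrite left_end_rcons; split; first by rewrite addr_ge0 ?cumul_ge0.
by rewrite -addrA -cumulS (le_trans _ IH1) // lerD2l cumul_le.
Qed.

(** A point belongs to the interval of [rcons s k] iff it belongs to that of [s]
   and its distance to the left end lies between two consecutive partial sums. *)
Lemma itinerary_cylinder u s : 0 <= u < 1 ->
  cylinder 0%N s (itinerary u) <-> left_end s <= u < left_end s + q s.
Proof.
move=> u01; elim/last_ind: s => [|s k IH].
  by rewrite /left_end big_ord0 q_nil add0r cylinder_nil.
rewrite cylinder_rcons left_end_rcons -addrA -cumulS.
have key : cylinder 0%N s (itinerary u) ->
    itinerary u (size s) = pick_child s (u - left_end s).
  by move=> /(cylinderP _ erefl); rewrite mkseq_itinerary /itinerary => ->.
split.
  move=> [us /= uk]; move: (us) => /key; rewrite uk => /esym/pick_childP.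
  move: us => /IH /andP[us1 us2].
  have /cumul_exceeds[i vi] : u - left_end s < q s by rewrite ltrBlDl.
  case=> [[vk kvj]|[_ /(_ i)]]; last by rewrite leNgt vi.
  rewrite -ltrBlDl vk andbT -lerBrDl.
  case: k kvj {uk vk} => [|k] kvj; last exact: kvj.
  by rewrite /cumul big_ord0 subr_ge0.
move=> /andP[uk1 uk2].
have us : cylinder 0%N s (itinerary u).
  apply/IH; rewrite (le_trans _ uk1) ?lerDl ?cumul_ge0 //=.
  by rewrite (lt_le_trans uk2) // lerD2l cumul_le.
split=> //=; rewrite key //; apply/pick_childP; left.
rewrite ltrBlDl; split=> // j jk; rewrite lerBrDl (le_trans _ uk1) // lerD2l.
exact: le_cumul.
Qed.

End nested_intervals.

Section unit_measure.
Context (R : realType).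

Definition unit_measure : set (measurableTypeR R) -> \bar R :=
  mrestr (@lebesgue_measure R) (measurable_itv `[0, 1[).

HB.instance Definition _ := Measure.on unit_measure.

Let unit_measureT : unit_measure setT = 1%E.
Proof. by rewrite /unit_measure /mrestr setTI lebesgue_measure_itv /= lte01 oppr0 adde0. Qed.

HB.instance Definition _ := @Measure_isProbability.Build _ _ R unit_measure unit_measureT.

Lemma unit_measure_itinerary (q : seq nat -> R) s :
  q [::] = 1 -> (forall s, 0 <= q s) ->
  (forall s, (\sum_(k <oo) (q (rcons s k))%:E = (q s)%:E)%E) ->
  unit_measure (itinerary q @^-1` cylinder 0%N s) = (q s)%:E.
Proof.
move=> q1 q0 qs; have [l0 l1] := left_end_bounds q1 q0 qs s.
rewrite /unit_measure /mrestr.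
have -> : itinerary q @^-1` cylinder 0%N s `&` `[0, 1[%classic =
    `[left_end q s, left_end q s + q s[%classic.
  apply/seteqP; split=> u /=; rewrite !in_itv /=.
    by move=> [us u01]; apply/(itinerary_cylinder q1 q0 qs).
  move=> us; have u01 : 0 <= u < 1.
    by case/andP: us => u1 u2; rewrite (le_trans l0)//= (lt_le_trans u2).
  by split=> //; apply/(itinerary_cylinder q1 q0 qs).
rewrite lebesgue_measure_itv /= lte_fin ltrDl; case: ltP => [_|qs0].
  by rewrite -EFinD addrC addKr.
by congr (_%:E); apply/eqP; rewrite eq_le q0 qs0.
Qed.

End unit_measure.

Arguments unit_measure : clear implicits.

Section measurable_itinerary.
Context d (S : measurableType d) (R : realType) (q : S -> seq nat -> R).
Hypothesis mq : forall s, measurable_fun [set: S] (q ^~ s).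

Let mcumul s k : measurable_fun [set: S] (fun z => cumul (q z) s k).
Proof. by apply: measurable_sum => j; exact: mq. Qed.

Let mleft_end s : measurable_fun [set: S] (fun z => left_end (q z) s).
Proof. by apply: measurable_sum => i; exact: mcumul. Qed.

Let msnd : measurable_fun [set: S * measurableTypeR R] (fun w => w.2 : R).
Proof. exact: measurable_snd. Qed.

Let offset s (w : S * measurableTypeR R) : R := w.2 - left_end (q w.1) s.

Let moffset s : measurable_fun [set: S * measurableTypeR R] (offset s).
Proof. by apply: measurable_funB => //; exact: (measurableT_comp (mleft_end s)). Qed.

Let mcumul1 s k : measurable_fun [set: S * measurableTypeR R] (fun w => cumul (q w.1) s k).
Proof. exact: (measurableT_comp (mcumul s k)). Qed.

Let mlt s k : measurable [set w | offset s w < cumul (q w.1) s k].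
Proof.
have := measurable_fun_ltr (moffset s) (mcumul1 s k).
by move=> /(_ measurableT [set true] I); rewrite setTI.
Qed.

Let mle s k : measurable [set w | cumul (q w.1) s k <= offset s w].
Proof.
have := measurable_fun_ler (mcumul1 s k) (moffset s).
by move=> /(_ measurableT [set true] I); rewrite setTI.
Qed.

Let mpick s k : measurable [set w | pick_child (q w.1) s (offset s w) = k].
Proof.
have -> : [set w | pick_child (q w.1) s (offset s w) = k] =
  ([set w | offset s w < cumul (q w.1) s k.+1] `&`
     \bigcap_(j in [set j | (j < k)%N]) [set w | cumul (q w.1) s j.+1 <= offset s w]) `|`
  (if k == 0%N then \bigcap_i [set w | cumul (q w.1) s i.+1 <= offset s w] else set0).
  apply/seteqP; split=> w /=.
    move=> /pick_childP[[h1 h2]|[-> h]]; first by left; split=> // j jk; exact: h2.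
    by right=> // i _; exact: h.
  move=> h; apply/pick_childP; case: h => [[h1 h2]|]; first by left; split=> // j jk; exact: h2.
  by case: eqP => // -> h; right; split=> // i; exact: h.
apply: measurableU.
  by apply: measurableI => //; apply: bigcap_measurableType => j _; exact: mle.
by case: ifP => _ //; apply: bigcap_measurableType => j _; exact: mle.
Qed.

(** The choice of a child is a countable combination of comparisons between
   measurable functions. *)
Lemma measurable_itinerary :
  measurable_fun [set: S * measurableTypeR R] (fun w => itinerary (q w.1) w.2).
Proof.
apply: measurable_fun_paths; elim/last_ind => [|s k IH].
  by rewrite cylinder_nil preimage_setT; exact: measurableT.
have -> : (fun w => itinerary (q w.1) w.2) @^-1` cylinder 0%N (rcons s k) =
   (fun w => itinerary (q w.1) w.2) @^-1` cylinder 0%N s `&`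
   [set w | pick_child (q w.1) s (offset s w) = k].
  rewrite cylinder_rcons; apply/seteqP; split=> w [] /= ws wk; split=> //;
  move: (ws) wk => /(cylinderP _ erefl); rewrite mkseq_itinerary /itinerary => -> //.
exact: measurableI.
Qed.

End measurable_itinerary.

(** * Sampling from a conditional law *)

Section slice.
Context d d' (S : measurableType d) (U : measurableType d') (R : realType).
Context (mu : probability S R) (lam : probability U R).

Lemma measurable_slice (V : set (S * U)) : measurable V ->
  measurable_fun [set: S] (fun z => lam (xsection V z)).
Proof. by move=> mV; exact: (measurable_fun_xsection lam). Qed.

Lemma product_measure_slice (D : set S) (V : set (S * U)) :
  measurable D -> measurable V ->
  (mu \x lam)%E ((D `*` setT) `&` V) = (\int[mu]_(z in D) lam (xsection V z))%E.
Proof.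
move=> mD mV; rewrite /product_measure1 [RHS]integral_mkcond /=.
apply: eq_integral => z _; rewrite /= patchE.
have [/set_mem Dz|] := boolP (z \in D).
  congr (lam _); apply/seteqP; split=> u; rewrite /xsection /= !inE.
    by case.
  by move=> Vzu; split.
rewrite notin_setE => nDz; rewrite (_ : xsection _ _ = set0) ?measure0//.
by apply/seteqP; split=> // u; rewrite /xsection /= inE => -[[]].
Qed.

End slice.

Lemma ae_eq_densities d (T : measurableType d) (R : realType)
    (mu : {finite_measure set T -> \bar R}) (g h : T -> \bar R) :
  measurable_fun [set: T] g -> measurable_fun [set: T] h ->
  (forall x, 0 <= g x)%E -> (forall x, 0 <= h x)%E ->
  (\int[mu]_x g x < +oo)%E ->
  (forall E, measurable E -> \int[mu]_(x in E) g x = \int[mu]_(x in E) h x)%E ->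
  {ae mu, forall x, g x = h x}.
Proof.
move=> mg mh g0 h0 goo gh.
have : ae_eq mu setT g h.
  apply: integral_ae_eq => //; last by move=> E _ mE; exact: gh.
  apply/integrableP; split=> //.
  by under eq_integral do rewrite gee0_abs//.
by apply: filterS => x; exact.
Qed.

Section cylinder_densities.
Context d d' (S : measurableType d) (T : measurableType d') (R : realType).
Context (mu : probability S R) (P : probability T R) (Z : T -> S).
Hypothesis mZ : measurable_fun [set: T] Z.
Hypothesis muE : forall D, measurable D -> mu D = P (Z @^-1` D).
Variable X : T -> paths 0%N.
Hypothesis mX : measurable_fun [set: T] X.

Let mXs s : measurable (X @^-1` cylinder 0%N s).
Proof. by rewrite -[Y in measurable Y]setTI; apply: mX => //; exact: measurable_cylinder. Qed.

(** The law of [Z] on the event that [X] starts with [s] is dominated by the whole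
   law of [Z], whence a density. Countable additivity of probability over the next
   letter holds for the densities after integration over any event, hence almost
   surely, and there are only countably many words. *)
Lemma cylinder_densities_exist : exists phi : S -> seq nat -> R,
  [/\ forall s, measurable_fun [set: S] (phi ^~ s),
      forall z s, 0 <= phi z s,
      {ae mu, forall z, phi z [::] = 1 /\
        forall s, (\sum_(k <oo) (phi z (rcons s k))%:E = (phi z s)%:E)%E} &
      forall s D, measurable D ->
        (\int[mu]_(z in D) (phi z s)%:E = P (Z @^-1` D `&` X @^-1` cylinder 0%N s))%E].
Proof.
have dens s : exists h : S -> \bar R, [/\ measurable_fun [set: S] h,
    (forall x, 0 <= h x)%E, (forall x, h x \is a fin_num) &
    forall D, measurable D ->
      P (X @^-1` cylinder 0%N s `&` Z @^-1` D) = (\int[mu]_(x in D) h x)%E].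
  apply: (@density_exists _ _ _ (image_on P (mXs s) mZ) mu) => D mD.
  rewrite [leRHS](muE mD) /image_on; apply: le_measure; rewrite ?inE //.
    by apply: measurableI => //; rewrite -[Y in measurable Y]setTI; exact: mZ.
  by rewrite -[Y in measurable Y]setTI; exact: mZ.
have {dens} [h hP] := choice dens.
have mh s : measurable_fun [set: S] (h s) by have [] := hP s.
have h0 s x : (0 <= h s x)%E by have [_ ->] := hP s.
have hfin s x : h s x \is a fin_num by have [_ _ ->] := hP s.
have hI s D : measurable D ->
    (\int[mu]_(x in D) h s x)%E = P (X @^-1` cylinder 0%N s `&` Z @^-1` D).
  by have [_ _ _ H] := hP s; move/H.
have hoo s : (\int[mu]_x h s x < +oo)%E.
  rewrite hI // preimage_setT setIT (le_lt_trans (probability_le1 _ _)) ?ltry//.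
have aen : {ae mu, forall z, h [::] z = 1%E}.
  apply: ae_eq_densities => // E mE.
  by rewrite integral_cst // mul1e [RHS](muE mE) hI // cylinder_nil preimage_setT setTI.
have aes : {ae mu, forall z, forall n, forall s, unpickle n = Some s ->
    (\sum_(k <oo) h (rcons s k) z)%E = h s z}.
  apply/ae_foralln => n; case E : (unpickle n) => [s|]; last by apply: aeW.
  suff : {ae mu, forall z, h s z = (\sum_(k <oo) h (rcons s k) z)%E}.
    by apply: filterS => z hz _ [<-].
  apply: ae_eq_densities => //.
  - by apply: ge0_emeasurable_sum => // k; exact: mh.
  - by move=> x; apply: nneseries_ge0 => k _ _; exact: h0.
  move=> D mD; rewrite integral_nneseries //; last by move=> k; exact: measurable_funTS.
  rewrite hI //.
  under eq_eseriesr do rewrite hI //.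
  have mZD : measurable (Z @^-1` D) by rewrite -[Y in measurable Y]setTI; exact: mZ.
  have -> : X @^-1` cylinder 0%N s `&` Z @^-1` D =
      \bigcup_k (X @^-1` cylinder 0%N (rcons s k) `&` Z @^-1` D).
    rewrite -setI_bigcupl; congr (_ `&` _).
    apply/seteqP; split=> w /=.
      by move=> ws; exists (X w (size s)) => //; rewrite /= cylinder_rcons.
    by move=> [k _]; rewrite /= cylinder_rcons => -[].
  rewrite (measure_bigcup P setT); first by apply: eq_eseriesl => k; rewrite in_setT.
    by move=> k _; apply: measurableI.
  move=> i j _ _ [w [[]]] /=; rewrite !cylinder_rcons => -[_ /= <-] _ [[_ /= <-]] _.
  by [].
exists (fun z s => fine (h s z)); split.
- by move=> s; apply: measurableT_comp.
- by move=> z s; apply: fine_ge0.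
- apply: filterS2 aen aes => z z1 zs; split; first by rewrite z1.
  move=> s; rewrite fineK // -(zs (pickle s) s (pickleK s)).
  by apply: eq_eseriesr => k _; rewrite fineK.
- move=> s D mD; rewrite setIC -hI //; apply: eq_integral => z _.
  by rewrite fineK.
Qed.

(** On almost every fiber the nested intervals give each cylinder the right mass,
   and cylinders determine measures on paths. *)
Lemma conditional_sampling_nat :
  exists X' : S * measurableTypeR R -> paths 0%N,
    measurable_fun [set: S * measurableTypeR R] X' /\
    forall D E, measurable D -> measurable E ->
      (\int[mu]_(z in D) unit_measure R (xsection (X' @^-1` E) z) =
       P (Z @^-1` D `&` X @^-1` E))%E.
Proof.
have [phi [mphi phi0 aephi phiI]] := cylinder_densities_exist.
pose X' (w : S * measurableTypeR R) := itinerary (phi w.1) w.2.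
exists X'; split; first exact: measurable_itinerary.
move=> D E mD mE.
have mX' : measurable_fun [set: S * measurableTypeR R] X' by exact: measurable_itinerary.
have mX'E F : measurable F -> measurable (X' @^-1` F).
  by move=> mF; rewrite -[Y in measurable Y]setTI; exact: mX'.
rewrite -product_measure_slice //; last exact: mX'E.
have mDT : measurable (D `*` [set: measurableTypeR R]) by apply: measurableX.
have mZD : measurable (Z @^-1` D) by rewrite -[Y in measurable Y]setTI; exact: mZ.
pose muU : probability (S * measurableTypeR R)%type R := (mu \x unit_measure R)%E.
pose m1 : {finite_measure set (paths 0%N) -> \bar R} := image_on muU mDT mX'.
pose m2 : {finite_measure set (paths 0%N) -> \bar R} := image_on P mZD mX.
suff m12 s : m1 (cylinder 0%N s) = m2 (cylinder 0%N s).
  apply: (@paths_measure_unique _ 0%N R m1 m2) m12 _ mE.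
  by rewrite -ge0_fin_numE //; exact: fin_num_measure.
rewrite /m1 /m2 /image_on /= /image_on /muU /= product_measure_slice //; last first.
  by apply: mX'E; exact: measurable_cylinder.
rewrite -phiI //; apply: ge0_ae_eq_integral => //.
- apply: measurable_funTS; apply: measurable_slice.
  by apply: mX'E; exact: measurable_cylinder.
- by apply: measurable_funTS; apply/measurable_EFinP.
- by move=> z _; rewrite lee_fin.
apply: filterS aephi => z [z1 zs] _.
rewrite -(unit_measure_itinerary s z1 (phi0 z) zs); congr (unit_measure R _).
by apply/seteqP; split=> u; rewrite /xsection /= inE.
Qed.

End cylinder_densities.

(** A randomisation lemma: a path-valued [X] can be resampled from its conditional
   law given [Z] as a measurable function of the value of [Z] and of a uniform
   variable. The left-hand side integrates, over [D], the probability that the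
   resampled path falls in [E] when the value of [Z] is [z]. *)
Lemma conditional_sampling d d' (S : measurableType d) (T : measurableType d')
    (R : realType) (A : countType) (a0 : A)
    (mu : probability S R) (P : probability T R) (Z : T -> S) (X : T -> paths a0) :
  measurable_fun [set: T] Z -> measurable_fun [set: T] X ->
  (forall D, measurable D -> mu D = P (Z @^-1` D)) ->
  exists X' : S * measurableTypeR R -> paths a0,
    measurable_fun [set: S * measurableTypeR R] X' /\
    forall D E, measurable D -> measurable E ->
      (\int[mu]_(z in D) unit_measure R (xsection (X' @^-1` E) z) =
       P (Z @^-1` D `&` X @^-1` E))%E.
Proof.
move=> mZ mX muE; pose enc := @map_paths A nat a0 0%N pickle.
pose dec := @map_paths nat A 0%N a0 (fun n => odflt a0 (unpickle n)).
have encK x : dec (enc x) = x.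
  by apply/funext => t; rewrite /dec /enc /map_paths pickleK.
have menc : measurable_fun [set: paths a0] enc by exact: measurable_map_paths.
have mdec : measurable_fun [set: paths 0%N] dec by exact: measurable_map_paths.
have [X' [mX' X'E]] := conditional_sampling_nat mZ muE (measurableT_comp menc mX).
exists (dec \o X'); split; first exact: measurableT_comp mdec mX'.
move=> D E mD mE; have mdE : measurable (dec @^-1` E).
  by rewrite -[Y in measurable Y]setTI; exact: mdec.
rewrite (_ : (dec \o X') @^-1` E = X' @^-1` (dec @^-1` E)) // X'E //.
by congr (P (_ `&` _)); apply/seteqP; split=> w; rewrite /= encK.
Qed.

(** * Conditional probabilities of prefixes given the image path *)

Section glue.
Context (C : countType) (c0 : C).
Implicit Types (s : seq C) (z : paths c0).

(** On the paths that start with [s] this inverts the shift by [size s], so there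
   every event is an event about the future. *)
Definition glue s (y : paths c0) : paths c0 :=
  fun i => if (i < size s)%N then nth c0 s i else y (i - size s)%N.

Lemma measurable_glue s : measurable_fun [set: paths c0] (glue s).
Proof.
apply: measurable_fun_coords => t a; rewrite /glue.
case: ltnP => _; last exact: (measurable_coord c0 _ [set a]).
have [->|h] := eqVneq (nth c0 s t) a.
  by rewrite (_ : [set _ | _] = setT) //; apply/seteqP; split.
rewrite (_ : [set _ | _] = set0) //; apply/seteqP; split=> // w /= e.
by rewrite e eqxx in h.
Qed.

Lemma glue_path_shift s z : cylinder c0 s z -> glue s (path_shift (size s) z) = z.
Proof.
move=> /(cylinderP _ erefl) zs; apply/funext => i; rewrite /glue /path_shift.
case: ltnP => [lt|le]; last by rewrite subnKC.
by rewrite -zs nth_mkseq.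
Qed.

End glue.

Lemma map_paths_cylinder (S S' : countType) (s0 : S) (s0' : S') (f : S -> S') s x :
  cylinder s0 s x -> cylinder s0' (map f s) (map_paths s0' f x).
Proof.
move=> /(cylinderP _ erefl) <-; apply/(cylinderP _ erefl).
by rewrite /mkseq -map_comp !size_map size_iota.
Qed.

Section weights.
Context (R : realType) (S : countType) (s0 : S).
Context (m : {finite_measure set (paths s0) -> \bar R}) (p : nat -> S -> S -> R).
Hypothesis p0 : forall t a b, 0 <= p t a b.
Hypothesis markov : markov_law m p.

(** The factor by which [past_weight] changes when the word grows by one letter; it
   does not depend on the past. *)
Definition weight_step n a b : R :=
  fine (m [set x | x n = a]) * p n a b / fine (m [set x | x n.+1 = b]).

Lemma past_weight_rcons s a b :
  past_weight m (rcons s a) b = past_weight m s a * weight_step (size s) a b.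
Proof.
rewrite [LHS]/past_weight size_rcons markov.
rewrite fineM //; last by apply: fin_num_measure; exact: measurable_cylinder.
rewrite (past_weightE m s a) fineM //; last first.
  by apply: fin_num_measure; exact: (measurable_coord s0 _ [set a]).
by rewrite /weight_step !mulrA.
Qed.

Definition at_time (n : nat) (a : S) : set (paths s0) := [set x | x n = a].

Lemma measurable_at_time n a : measurable (at_time n a).
Proof. exact: (measurable_coord s0 _ [set a]). Qed.

(** Conditioning on a visit to [a] at time [n] would require dividing by its
   probability; the restricted law is left unnormalised so that null visits
   need no separate treatment. *)
Definition future_law n a :=
  image_on m (measurable_at_time n a) (@measurable_path_shift S s0 n).

HB.instance Definition _ n a := FiniteMeasure.on (future_law n a).

(** Integral form of [past_future], for functions of the future. *)
Lemma integral_future s a (G : set (paths s0)) (h : paths s0 -> \bar R) :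
  measurable G -> measurable_fun [set: paths s0] h -> (forall x, 0 <= h x)%E ->
  (\int[m]_(x in cylinder s0 (rcons s a) `&` path_shift (size s) @^-1` G)
      h (path_shift (size s) x) =
   (past_weight m s a)%:E * \int[future_law (size s) a]_(x in G) h x)%E.
Proof.
move=> mG mh h0.
rewrite -(integral_image_on m (measurable_cylinder s0 (rcons s a))
  (@measurable_path_shift S s0 (size s))) //.
rewrite -(ge0_integral_mscale _ mG (NngNum (past_weight_ge0 m s a))) //; last first.
  exact: measurable_funTS.
by apply: eq_measure_integral => E mE _; exact: (past_future p0 markov).
Qed.

End weights.

Section lumping.
Context (R : realType) (A C : countType) (a0 : A) (c0 : C) (f : A -> C).
Context (mX : probability (paths a0) R) (mZ : probability (paths c0) R).
Context (pX : nat -> A -> A -> R) (pZ : nat -> C -> C -> R).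
Hypothesis pX0 : forall t a b, 0 <= pX t a b.
Hypothesis pZ0 : forall t a b, 0 <= pZ t a b.
Hypothesis markovX : markov_law mX pX.
Hypothesis markovZ : markov_law mZ pZ.
Local Notation F := (@map_paths A C a0 c0 f).
Hypothesis mZE : forall D, measurable D -> mZ D = mX (F @^-1` D).

Let mF : measurable_fun [set: paths a0] F.
Proof. exact: measurable_map_paths. Qed.

Let mFI D : measurable D -> measurable (F @^-1` D).
Proof. by move=> mD; rewrite -[Y in measurable Y]setTI; exact: mF. Qed.

(** A visit of the chain to [a] is a visit of its image to [f a], so the future of
   the image seen from [a] has a density with respect to the one seen from [f a]. *)
Lemma future_density_exists : exists h : nat -> A -> paths c0 -> \bar R,
  forall n a, [/\ measurable_fun [set: paths c0] (h n a),
    (forall z, 0 <= h n a z)%E &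
    forall D, measurable D ->
      (\int[future_law mZ n (f a)]_(z in D) h n a z =
       mX (at_time n a `&` path_shift n @^-1` (F @^-1` D)))%E].
Proof.
suff /choice[h hP] : forall na : nat * A, exists h : paths c0 -> \bar R,
    [/\ measurable_fun [set: paths c0] h, (forall z, 0 <= h z)%E &
    forall D, measurable D ->
      (\int[future_law mZ na.1 (f na.2)]_(z in D) h z =
       mX (at_time na.1 na.2 `&` path_shift na.1 @^-1` (F @^-1` D)))%E].
  by exists (fun n a => h (n, a)) => n a; exact: (hP (n, a)).
move=> [n a] /=.
pose nu := image_on mX (measurable_at_time a0 n a)
  (measurableT_comp mF (@measurable_path_shift A a0 n)).
have [|h [mh h0 _ hE]] := @density_exists _ _ _ nu (future_law mZ n (f a)).
  move=> D mD; rewrite /= /future_law /nu /image_on mZE; last first.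
    apply: measurableI; first exact: measurable_at_time.
    by rewrite -[Y in measurable Y]setTI; apply: measurable_path_shift.
  apply: le_measure; rewrite ?inE.
  - apply: measurableI; first exact: measurable_at_time.
    rewrite -[Y in measurable Y]setTI.
    by apply: (measurableT_comp mF (@measurable_path_shift A a0 n)).
  - apply: mFI; apply: measurableI; first exact: measurable_at_time.
    by rewrite -[Y in measurable Y]setTI; apply: measurable_path_shift.
  - by move=> x [xa xD]; split=> //; rewrite /at_time /= /map_paths xa.
by exists h; split=> // D mD; rewrite -hE.
Qed.

(** A word of the chain is null as soon as its image is null, which makes the
   quotient of the two weights meaningful. *)
Lemma past_weight_lumped s a :
  past_weight mZ (map f s) (f a) = 0 -> past_weight mX s a = 0.
Proof.
move=> w0; rewrite /past_weight.
suff e : mX (cylinder a0 (rcons s a)) = 0%E by rewrite [X in fine X / _]e mul0r.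
apply: (@subset_measure0 _ _ _ mX _ (F @^-1` cylinder c0 (rcons (map f s) (f a)))).
- exact: measurable_cylinder.
- by apply: mFI; exact: measurable_cylinder.
- by move=> x xs /=; rewrite -map_rcons; exact: map_paths_cylinder.
- apply: etrans (esym (mZE (measurable_cylinder _ _))) _.
  by rewrite [LHS](past_weightE mZ) w0 mul0e.
Qed.

(** Integrate both sides over [D]. On the paths that start with [map f (rcons s a)]
   the event [D] is an event about the future, so the Markov property of the
   chain turns the left side into an integral of [h] against [future_law], and the
   Markov property of the image does the same for the right side. *)
Lemma lumped_density s a (phi : paths c0 -> \bar R) (h : nat -> A -> paths c0 -> \bar R) :
  measurable_fun [set: paths c0] phi -> (forall z, 0 <= phi z)%E ->
  (forall D, measurable D ->
    \int[mZ]_(z in D) phi z = mX (F @^-1` D `&` cylinder a0 (rcons s a)))%E ->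
  measurable_fun [set: paths c0] (h (size s) a) -> (forall z, 0 <= h (size s) a z)%E ->
  (forall D, measurable D ->
      (\int[future_law mZ (size s) (f a)]_(z in D) h (size s) a z =
       mX (at_time (size s) a `&` path_shift (size s) @^-1` (F @^-1` D)))%E) ->
  {ae mZ, forall z, phi z =
    ((past_weight mX s a / past_weight mZ (map f s) (f a))%:E *
     ((\1_(cylinder c0 (rcons (map f s) (f a))) z)%:E * h (size s) a (path_shift (size s) z)))%E}.
Proof.
move=> mphi phi0 phiE mh h0 hE.
set u := rcons (map f s) (f a); set c := (_ / _)%R.
have c_ge0 : 0 <= c by rewrite divr_ge0 ?past_weight_ge0.
have mhs : measurable_fun [set: paths c0] (fun z => h (size s) a (path_shift (size s) z)).
  by apply: (measurableT_comp mh); exact: measurable_path_shift.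
have mind : measurable_fun [set: paths c0] (fun z => (\1_(cylinder c0 u) z)%:E : \bar R).
  by apply/measurable_EFinP; apply: measurable_indic; exact: measurable_cylinder.
apply: ae_eq_densities => //.
- by apply: emeasurable_funM => //; apply: emeasurable_funM.
- by move=> z; rewrite !mule_ge0 // lee_fin.
- by rewrite phiE // (le_lt_trans (probability_le1 _ _)) ?ltry //; apply: measurableI;
    [exact: mFI|exact: measurable_cylinder].
move=> D mD; rewrite phiE //.
pose G := glue (map f s) @^-1` D : set (paths c0).
have mG : measurable G by rewrite -[Y in measurable Y]setTI; exact: measurable_glue.
have -> : F @^-1` D `&` cylinder a0 (rcons s a) =
    cylinder a0 (rcons s a) `&` path_shift (size s) @^-1` (F @^-1` G).
  rewrite setIC; apply/seteqP; split=> x [xs xD]; split=> //; move: xD; rewrite /G /=;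
  have -> : F (path_shift (size s) x) = path_shift (size (map f s)) (F x) by rewrite size_map.
    rewrite glue_path_shift //; apply: map_paths_cylinder.
    by move: xs; rewrite cylinder_rcons => -[].
  rewrite glue_path_shift //; apply: map_paths_cylinder.
  by move: xs; rewrite cylinder_rcons => -[].
rewrite [LHS](past_future pX0 markovX _ _ (mFI mG)) -[X in (_ * X)%E](hE _ mG).
rewrite ge0_integralZl //; first last.
- by move=> z _; rewrite mule_ge0 // lee_fin.
- by apply: measurable_funTS; apply: emeasurable_funM.
have -> : (\int[mZ]_(z in D) ((\1_(cylinder c0 u) z)%:E * h (size s) a (path_shift (size s) z)) =
    \int[mZ]_(z in cylinder c0 u `&` path_shift (size s) @^-1` G)
      h (size s) a (path_shift (size s) z))%E.
  have -> : cylinder c0 u `&` path_shift (size s) @^-1` G = D `&` cylinder c0 u.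
    rewrite setIC; apply/seteqP; split=> z [zs zD]; split=> //; move: zs; rewrite /G /=;
    have <- : size (map f s) = size s by rewrite size_map.
      by rewrite glue_path_shift //; move: zD; rewrite cylinder_rcons => -[].
    by rewrite glue_path_shift //; move: zD; rewrite cylinder_rcons => -[].
  rewrite [RHS]integral_mkcondr; apply: eq_integral => z _.
  rewrite patchE indicE; case: ifP => _; by rewrite ?mul1e ?mul0e.
have -> : size s = size (map f s) by rewrite size_map.
rewrite (integral_future pZ0 markovZ) ?size_map //.
rewrite muleA -EFinM; congr (_%:E * _)%E.
rewrite /c; have [w0|w0] := eqVneq (past_weight mZ (map f s) (f a)) 0; last by rewrite divfK.
by rewrite past_weight_lumped // !mul0r.
Qed.

End lumping.

Section joint_prefixes.
Context (R : realType) (A B C : countType) (a0 : A) (b0 : B) (c0 : C).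
Context (f : A -> C) (g : B -> C).
Context (mX : probability (paths a0) R) (mY : probability (paths b0) R).
Context (mZ : probability (paths c0) R).
Context (pX : nat -> A -> A -> R) (pY : nat -> B -> B -> R) (pZ : nat -> C -> C -> R).
Hypothesis pX0 : forall t a b, 0 <= pX t a b.
Hypothesis pY0 : forall t a b, 0 <= pY t a b.
Hypothesis pZ0 : forall t a b, 0 <= pZ t a b.
Hypothesis markovX : markov_law mX pX.
Hypothesis markovY : markov_law mY pY.
Hypothesis markovZ : markov_law mZ pZ.
Hypothesis mZX : forall D, measurable D -> mZ D = mX (map_paths c0 f @^-1` D).
Hypothesis mZY : forall D, measurable D -> mZ D = mY (map_paths c0 g @^-1` D).
Context (phi : seq A -> paths c0 -> \bar R) (psi : seq B -> paths c0 -> \bar R).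
Hypothesis mphi : forall s, measurable_fun [set: paths c0] (phi s).
Hypothesis mpsi : forall s, measurable_fun [set: paths c0] (psi s).
Hypothesis phi0 : forall s z, (0 <= phi s z)%E.
Hypothesis psi0 : forall s z, (0 <= psi s z)%E.
Hypothesis phiE : forall s D, measurable D ->
  (\int[mZ]_(z in D) phi s z = mX (map_paths c0 f @^-1` D `&` cylinder a0 s))%E.
Hypothesis psiE : forall s D, measurable D ->
  (\int[mZ]_(z in D) psi s z = mY (map_paths c0 g @^-1` D `&` cylinder b0 s))%E.

(** The factor of the probability of two prefixes that remembers their past; what is
   left, [H] in [joint_prefix_factor], is a function of the present. *)
Definition joint_weight s a t b : R :=
  if map f (rcons s a) == map g (rcons t b) then
    past_weight mX s a * past_weight mY t b / past_weight mZ (map f s) (f a)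
  else 0.

Definition joint_weight_step n a b a' b' : R :=
  if f a' == g b' then
    weight_step mX pX n a a' * weight_step mY pY n b b' / weight_step mZ pZ n (f a) (f a')
  else 0.

Lemma joint_weight_rcons s a t b a' b' : size s = size t ->
  joint_weight (rcons s a) a' (rcons t b) b' =
  joint_weight s a t b * joint_weight_step (size s) a b a' b'.
Proof.
move=> st; rewrite /joint_weight /joint_weight_step !map_rcons eqseq_rcons.
case: eqP => _; last by rewrite mul0r.
case: eqP => _ /=; last by rewrite mulr0.
rewrite (past_weight_rcons markovX) (past_weight_rcons markovY) (past_weight_rcons markovZ).
by rewrite size_map -st invfM; ring.
Qed.

(** The product of the two conditional probabilities given by [lumped_density] is a
   constant times a function of the future of the image, so the Markov property of
   the image separates the two factors once more. *)
Lemma joint_prefix_factor : exists H : nat -> A -> B -> \bar R,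
  forall s a t b, size s = size t ->
    (\int[mZ]_z (phi (rcons s a) z * psi (rcons t b) z) =
     (joint_weight s a t b)%:E * H (size s) a b)%E.
Proof.
have [h hP] := future_density_exists mZX.
have [k kP] := future_density_exists mZY.
exists (fun n a b => \int[future_law mZ n (f a)]_z (h n a z * k n b z))%E.
move=> s a t b st.
have mh : measurable_fun [set: paths c0] (h (size s) a) by have [] := hP (size s) a.
have h0 z : (0 <= h (size s) a z)%E by have [_ ->] := hP (size s) a.
have hE D : measurable D -> (\int[future_law mZ (size s) (f a)]_(z in D) h (size s) a z =
    mX (at_time (size s) a `&` path_shift (size s) @^-1` (map_paths c0 f @^-1` D)))%E.
  by have [_ _ H] := hP (size s) a; exact: H.
have mk : measurable_fun [set: paths c0] (k (size t) b) by have [] := kP (size t) b.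
have k0 z : (0 <= k (size t) b z)%E by have [_ ->] := kP (size t) b.
have kE D : measurable D -> (\int[future_law mZ (size t) (g b)]_(z in D) k (size t) b z =
    mY (at_time (size t) b `&` path_shift (size t) @^-1` (map_paths c0 g @^-1` D)))%E.
  by have [_ _ H] := kP (size t) b; exact: H.
have aephi := lumped_density pX0 pZ0 markovX markovZ mZX (mphi (rcons s a))
  (phi0 (rcons s a)) (@phiE (rcons s a)) mh h0 hE.
have aepsi := lumped_density pY0 pZ0 markovY markovZ mZY (mpsi (rcons t b))
  (psi0 (rcons t b)) (@psiE (rcons t b)) mk k0 kE.
set u := rcons (map f s) (f a) in aephi; set v := rcons (map g t) (g b) in aepsi.
set al := (_ / _)%R in aephi; set be := (_ / _)%R in aepsi.
have al0 : 0 <= al by rewrite divr_ge0 ?past_weight_ge0.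
have be0 : 0 <= be by rewrite divr_ge0 ?past_weight_ge0.
pose hk (z : paths c0) := (h (size s) a z * k (size t) b z)%E.
have mhk : measurable_fun [set: paths c0] hk by exact: emeasurable_funM.
have hk0 z : (0 <= hk z)%E by rewrite mule_ge0.
have mhks : measurable_fun [set: paths c0] (fun z => hk (path_shift (size s) z)).
  by apply: (measurableT_comp mhk); exact: measurable_path_shift.
have mcu w : measurable (cylinder c0 w) by exact: measurable_cylinder.
have -> : (\int[mZ]_z (phi (rcons s a) z * psi (rcons t b) z) =
    \int[mZ]_z ((al * be)%:E *
      ((\1_(cylinder c0 u `&` cylinder c0 v) z)%:E * hk (path_shift (size s) z))))%E.
  apply: ge0_ae_eq_integral => //.
  - exact: emeasurable_funM.
  - apply: emeasurable_funM => //; apply: emeasurable_funM => //.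
    by apply/measurable_EFinP; apply: measurable_indic; exact: measurableI.
  - by move=> z _; rewrite mule_ge0.
  - by move=> z _; rewrite !mule_ge0 // lee_fin // mulr_ge0.
  apply: filterS2 aephi aepsi => z -> -> _.
  by rewrite muleACA [X in (_ * X)%E = _]muleACA indicI /= !EFinM /hk -st.
rewrite ge0_integralZl //; first last.
- by rewrite lee_fin mulr_ge0.
- by move=> z _; rewrite mule_ge0 // lee_fin.
- apply: emeasurable_funM => //.
  by apply/measurable_EFinP; apply: measurable_indic; exact: measurableI.
rewrite /joint_weight !map_rcons -/u -/v.
have -> : (\int[mZ]_z ((\1_(cylinder c0 u `&` cylinder c0 v) z)%:E * hk (path_shift (size s) z)) =
    \int[mZ]_(z in cylinder c0 u `&` cylinder c0 v) hk (path_shift (size s) z))%E.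
  rewrite [RHS]integral_mkcond; apply: eq_integral => z _.
  by rewrite patchE indicE; case: ifP => _; rewrite ?mul1e ?mul0e.
case: eqP => [uv|uv]; last first.
  rewrite (_ : cylinder c0 u `&` cylinder c0 v = set0) ?integral_set0 ?mule0 ?mul0e //.
  apply/seteqP; split=> // z [zu zv]; apply: uv.
  have suv : size u = size v by rewrite !size_rcons !size_map st.
  by rewrite -zu -zv suv.
rewrite -uv setIid.
have -> : cylinder c0 u = cylinder c0 u `&` path_shift (size (map f s)) @^-1` setT.
  by rewrite preimage_setT setIT.
have -> : size s = size (map f s) by rewrite size_map.
rewrite (integral_future pZ0 markovZ) //.
rewrite muleA -EFinM; congr (_%:E * _)%E; last by rewrite /hk -st size_map.
have [eqm eqfg] : map f s = map g t /\ f a = g b by move/rcons_inj: uv => [].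
rewrite /al /be -eqm -eqfg.
have [->|w0] := eqVneq (past_weight mZ (map f s) (f a)) 0; first by rewrite mulr0 invr0 mulr0.
by field.
Qed.

End joint_prefixes.

(** * Markov chains and null modifications *)

Section path_law.
Context d (T : measurableType d) (R : realType) (P : probability T R).
Context (S : Type) (s0 : S) (X : T -> paths s0) (mX : measurable_fun [set: T] X).

Definition path_law : set (paths s0) -> \bar R :=
  image_on P measurableT mX.

HB.instance Definition _ := Measure.on (path_law).

Let path_lawT : path_law setT = 1%E.
Proof. by rewrite /path_law /image_on preimage_setT setTI probability_setT. Qed.

HB.instance Definition _ := @Measure_isProbability.Build _ _ R (path_law) path_lawT.

Lemma path_lawE E : path_law E = P (X @^-1` E).
Proof. by rewrite /path_law /image_on setTI. Qed.

End path_law.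

Lemma measurable_history d (T : measurableType d) (S : countType) (X : nat -> T -> S) x t :
  is_process X -> measurable (history X x t).
Proof.
move=> pX; have -> : history X x t = \bigcap_(s in [set s | (s <= t)%N]) (X s @^-1` [set x s]).
  by apply/seteqP; split=> w h s; exact: h.
by apply: bigcap_measurableType => s _; exact: pX.
Qed.

Lemma countable_process d (T : measurableType d) (S : countType) (X : nat -> T -> S) :
  (forall t a, measurable (X t @^-1` [set a])) -> is_process X.
Proof.
move=> mX t U; rewrite (_ : X t @^-1` U = \bigcup_(a in U) (X t @^-1` [set a])).
  rewrite bigcup_mkcond; apply: countable_bigcupT_measurable; first exact: countableP.
  by move=> a; case: ifPn.
apply/seteqP; split=> w /=; first by move=> Uw; exists (X t w).
by move=> [a Ua /= ->].
Qed.

Lemma fine_div_cross (R : realType) (x y c d : \bar R) :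
  x \is a fin_num -> y \is a fin_num -> c \is a fin_num -> d \is a fin_num ->
  c != 0%E -> d != 0%E -> (x * d = y * c)%E -> fine x / fine c = fine y / fine d.
Proof.
move: x y c d => [x| |] [y| |] [c| |] [d| |] //= _ _ _ _.
rewrite !eqe => c0 d0 [] xd_yc; apply/eqP.
by rewrite eqr_div // -xd_yc.
Qed.

Section chains.
Context d (T : measurableType d) (R : realType) (P : probability T R) (S : countType).

Lemma fine_probabilityE E : measurable E -> P E = (fine (P E))%:E.
Proof. by move=> mE; rewrite fineK // fin_num_measure. Qed.

Lemma markov_chain_transition mu p (X : nat -> T -> S) : markov_chain P mu p X ->
  forall t x b, P (history X x t `&` X t.+1 @^-1` [set b]) =
    (P (history X x t) * (p t (x t) b)%:E)%E.
Proof.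
move=> [pX _ _ _ trans] t x b.
have mh := measurable_history x t pX; have mb := pX t.+1 [set b].
have mhb := measurableI _ _ mh mb.
have [h0|h0] := eqVneq (P (history X x t)) 0%E.
  by rewrite h0 mul0e; apply: subset_measure0 h0.
rewrite -trans // /cprob setIC (fine_probabilityE mh) -EFinM mulrCA divff ?mulr1.
  by rewrite -fine_probabilityE // setIC.
by apply: contra_neq h0 => e; rewrite (fine_probabilityE mh) e.
Qed.

(** The row of the transition matrix at [t] and [a] can be read off from any
   single history of positive probability that ends in [a], as the product form
   of the hypothesis makes all of them agree; the rows of the states that are
   never visited are chosen to stay put, which keeps the matrix stochastic. *)
Lemma markov_chain_of_histories (X : nat -> T -> S) : is_process X ->
  (forall t x y b, x t = y t ->
    (P (history X x t `&` X t.+1 @^-1` [set b]) * P (history X y t) =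
     P (history X y t `&` X t.+1 @^-1` [set b]) * P (history X x t))%E) ->
  exists mu p, markov_chain P mu p X.
Proof.
move=> pX cross.
pose good t a (x : nat -> S) := x t = a /\ P (history X x t) != 0%E.
pose p t a b : R := if pselect (exists x, good t a x) is left ex
  then cprob P (X t.+1 @^-1` [set b]) (history X (sval (cid ex)) t) else (a == b)%:R.
have mh x t : measurable (history X x t) by exact: measurable_history.
have mb t b : measurable (X t @^-1` [set b]) by exact: pX.
have dist (E : set T) t : measurable E -> P E != 0%E ->
    is_distribution (fun b => cprob P (X t @^-1` [set b]) E).
  move=> mE E0; have fE0 : fine (P E) != 0.
    by apply: contra_neq E0 => e; rewrite fine_probabilityE // e.
  split=> [b|]; first by rewrite /cprob divr_ge0 ?fine_ge0.
  have r0 : 0 <= (fine (P E))^-1 by rewrite invr_ge0 fine_ge0.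
  have := measure_fibers (mscale (NngNum r0) P) mE (mb t).
  rewrite /mscale /= => e; transitivity ((fine (P E))^-1%:E * P E)%E; last first.
    by rewrite [X in (_ * X)%E]fine_probabilityE // -EFinM mulVf.
  apply: etrans (esym e); apply: eq_esum => b _; rewrite /cprob mulrC EFinM setIC.
  by rewrite -fine_probabilityE //; exact: measurableI.
exists (fun a => fine (P (X 0%N @^-1` [set a]))), p; split=> //.
- have := dist setT 0%N measurableT; rewrite probability_setT => /(_ (oner_neq0 _)) h.
  by move: h; rewrite /cprob probability_setT /= => -[h1 h2]; split=> [a|];
    [move: (h1 a)|rewrite -[RHS]h2; apply: eq_esum => a _]; rewrite setIT divr1.
- move=> t a; rewrite /p; case: pselect => [ex|_].
    by apply: dist => //; case: (cid ex) => x [].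
  split=> [b|]; first by case: eqP.
  rewrite (esumID [set a]); last by move=> b _; rewrite lee_fin.
  rewrite setTI esum_set1 ?eqxx ?lee_fin // esum1 ?adde0 //.
  by move=> b [_ /= /eqP]; rewrite eq_sym => /negbTE ->.
- by move=> a; rewrite -fine_probabilityE.
move=> t x b x0; rewrite /p; case: pselect => [ex|]; last by case; exists x.
case: (cid ex) => y [yx y0] /=.
rewrite /cprob (setIC (X t.+1 @^-1` [set b]) (history X x t)).
rewrite (setIC (X t.+1 @^-1` [set b]) (history X y t)).
have fin E : measurable E -> P E \is a fin_num by exact: fin_num_measure.
by apply: fine_div_cross; rewrite ?fin ?(cross t x y b (esym yx)) //; exact: measurableI.
Qed.

End chains.

Section null_modification.
Context d (T : measurableType d) (R : realType) (P : probability T R).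

Lemma measure_eq_off_null (N U V : set T) : measurable N -> measurable U -> measurable V ->
  P N = 0%E -> U `&` ~` N = V `&` ~` N -> P U = P V.
Proof.
move=> mN mU mV N0 UV.
have split_off W : measurable W -> P W = P (W `&` ~` N).
  move=> mW; have mWN := measurableI _ _ mW mN.
  rewrite -[in LHS](setUIDK W N) measureU //; first 1 last.
  - exact: measurableD.
  - by apply/seteqP; split=> // w [[_ ?] [_ ?]].
  by rewrite (subset_measure0 _ _ _ N0) ?add0e //; exact: subIsetr.
by rewrite split_off // UV -split_off.
Qed.

Context (C : countType) (c0 : C) (H K : T -> paths c0).
Hypotheses (mH : measurable_fun [set: T] H) (mK : measurable_fun [set: T] K).

Let disagree (n : nat) : set T :=
  if unpickle n is Some tc
  then [set w | H w (tc : nat * C).1 = tc.2] `&` [set w | K w tc.1 <> tc.2] else set0.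

Let mdisagree n : measurable (disagree n).
Proof.
rewrite /disagree; case: unpickle => [[t c]|] //; apply: measurableI.
  by rewrite -[X in measurable X]setTI; exact: (mH measurableT (measurable_coord c0 t [set c])).
by rewrite -[X in measurable X]setTI; exact: (mK measurableT (measurable_coord c0 t (~` [set c]))).
Qed.

Let disagreeE : [set w | H w <> K w] = \bigcup_n disagree n.
Proof.
apply/seteqP; split=> w /=.
  move=> HK; have [t Ht] : exists t, H w t <> K w t.
    by apply: contrapT => /forallNP h; apply: HK; apply/funext => t; apply: contrapT.
  exists (pickle (t, H w t)) => //; rewrite /disagree pickleK; split=> //=.
  by move=> e; exact: Ht.
by move=> [n _]; rewrite /disagree; case: unpickle => [[t c]|] // [/= <-] h e; rewrite e in h.
Qed.

Lemma measurable_paths_neq : measurable [set w | H w <> K w].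
Proof. by rewrite disagreeE; exact: bigcupT_measurable. Qed.

(** Two paths that differ do so at some time [t] with some value [c] of the first;
   there are countably many such pairs. *)
Lemma paths_neq_null :
  (forall t c, P ([set w | H w t = c] `&` [set w | K w t <> c]) = 0%E) ->
  P [set w | H w <> K w] = 0%E.
Proof.
move=> h; apply/negligibleP; first exact: measurable_paths_neq.
rewrite disagreeE; apply: negligible_bigcup => n; apply/negligibleP => //.
by rewrite /disagree; case: unpickle => [[t c]|]; [exact: h|exact: measure0].
Qed.

End null_modification.

(** * The conditionally independent coupling *)

Section coupling.
Context (R : realType) (A B C : countType) (a0 : A) (b0 : B) (c0 : C).
Context (f : A -> C) (g : B -> C).
Context (mX : probability (paths a0) R) (mY : probability (paths b0) R).
Context (mZ : probability (paths c0) R).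
Local Notation F := (map_paths c0 f : paths a0 -> paths c0).
Local Notation G := (map_paths c0 g : paths b0 -> paths c0).
Hypothesis mZX : forall D, measurable D -> mZ D = mX (F @^-1` D).
Hypothesis mZY : forall D, measurable D -> mZ D = mY (G @^-1` D).

Let mF : measurable_fun [set: paths a0] F. Proof. exact: measurable_map_paths. Qed.
Let mG : measurable_fun [set: paths b0] G. Proof. exact: measurable_map_paths. Qed.

(** A choice, for every event [E], of a version [k E] of the conditional probability
   of [E] under [m] given the image path [h]. *)
Definition is_path_kernel (S : Type) (s0 : S) (h : paths s0 -> paths c0)
    (m : set (paths s0) -> \bar R) (k : set (paths s0) -> paths c0 -> \bar R) :=
  [/\ forall E, measurable E -> measurable_fun [set: paths c0] (k E),
      forall E z, measurable E -> (0 <= k E z <= 1)%E,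
      forall z, k setT z = 1%E &
      forall E D, measurable E -> measurable D ->
        (\int[mZ]_(z in D) k E z = m (h @^-1` D `&` E))%E].

Let sample (S : countType) (s0 : S) (h : paths s0 -> paths c0) (m : probability (paths s0) R) :
  measurable_fun [set: paths s0] h -> (forall D, measurable D -> mZ D = m (h @^-1` D)) ->
  exists X' : paths c0 * measurableTypeR R -> paths s0,
    measurable_fun [set: paths c0 * measurableTypeR R] X' /\
    is_path_kernel h m (fun E z => unit_measure R (xsection (X' @^-1` E) z)).
Proof.
move=> mh mE; have [X' [mX' X'E]] := conditional_sampling mh (@measurable_id _ _ setT) mE.
exists X'; split=> //.
have mI E : measurable E -> measurable (X' @^-1` E).
  by move=> ?; rewrite -[Y in measurable Y]setTI; exact: mX'.
split=> [E /mI|E z /mI||E D ? ?].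
- exact: measurable_slice.
- by move=> ?; rewrite measure_ge0 probability_le1 //; exact: measurable_xsection.
- move=> z; rewrite preimage_setT (_ : xsection _ _ = setT) ?probability_setT //.
  by apply/seteqP; split=> // u _; rewrite /xsection /= inE.
- by rewrite X'E.
Qed.

(** The formula for the joint law says that, given the image path, [X] and [Y] are
   independent with conditional laws [kX] and [kY]. *)
Lemma conditional_coupling : exists (d : measure_display) (T : measurableType d)
    (P : probability T R) (X : T -> paths a0) (Y : T -> paths b0)
    (kX : set (paths a0) -> paths c0 -> \bar R) (kY : set (paths b0) -> paths c0 -> \bar R),
  [/\ measurable_fun [set: T] X, measurable_fun [set: T] Y,
      forall w, F (X w) = G (Y w),
      is_path_kernel F mX kX /\ is_path_kernel G mY kY &
      forall D E E', measurable D -> measurable E -> measurable E' ->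
        P ((F \o X) @^-1` D `&` (X @^-1` E `&` Y @^-1` E')) =
        (\int[mZ]_(z in D) (kX E z * kY E' z))%E].
Proof.
have [X' [mX' kXP]] := sample mF mZX; have [Y' [mY' kYP]] := sample mG mZY.
set kX := (fun E z => _) in kXP; set kY := (fun E z => _) in kYP.
pose U := measurableTypeR R; pose T := (paths c0 * (U * U))%type.
pose lam : probability (U * U)%type R := (unit_measure R \x unit_measure R)%E.
pose P : probability T R := (mZ \x lam)%E.
pose X1 (w : T) := X' (w.1, w.2.1); pose Y1 (w : T) := Y' (w.1, w.2.2).
have mX1 : measurable_fun [set: T] X1.
  apply: (measurableT_comp mX'); apply: measurable_fun_pair => //.
  exact: (measurableT_comp measurable_fst).
have mY1 : measurable_fun [set: T] Y1.
  apply: (measurableT_comp mY'); apply: measurable_fun_pair => //.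
  exact: (measurableT_comp measurable_snd).
have mX1I E : measurable E -> measurable (X1 @^-1` E).
  by move=> ?; rewrite -[V in measurable V]setTI; exact: mX1.
have mY1I E : measurable E -> measurable (Y1 @^-1` E).
  by move=> ?; rewrite -[V in measurable V]setTI; exact: mY1.
have law1 D E E' : measurable D -> measurable E -> measurable E' ->
    P ((D `*` setT) `&` (X1 @^-1` E `&` Y1 @^-1` E')) = (\int[mZ]_(z in D) (kX E z * kY E' z))%E.
  move=> mD mE mE'; rewrite /P /= product_measure_slice //; last first.
    exact: measurableI (mX1I _ mE) (mY1I _ mE').
  apply: eq_integral => z _.
  have -> : xsection (X1 @^-1` E `&` Y1 @^-1` E') z =
      xsection (X' @^-1` E) z `*` xsection (Y' @^-1` E') z.
    by apply/seteqP; split=> -[u v]; rewrite /xsection /= !inE.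
  rewrite /lam /= product_measure1E //; apply: measurable_xsection;
    rewrite -[V in measurable V]setTI; [exact: mX'|exact: mY'].
clearbody P kX kY.
have [mkX kX01 kX1 kXE] := kXP; have [mkY kY01 kY1 kYE] := kYP.
(* The rectangle [z t <> c] and [f (x t) = c] is null under the law of the chain
   and its image, whatever the time [t] and the state [c]. *)
pose NX := [set w | F (X1 w) <> w.1]; pose NY := [set w | G (Y1 w) <> w.1].
have mfst : measurable_fun [set: T] fst by exact: measurable_fst.
have mNX : measurable NX by apply: measurable_paths_neq => //; exact: (measurableT_comp mF mX1).
have mNY : measurable NY by apply: measurable_paths_neq => //; exact: (measurableT_comp mG mY1).
have NX0 : P NX = 0%E.
  apply: (@paths_neq_null _ _ R P C c0 (F \o X1) fst (measurableT_comp mF mX1) mfst) => t c.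
  have mD : measurable [set z : paths c0 | z t <> c] by exact: (measurable_coord c0 t (~` [set c])).
  have mE : measurable [set x : paths a0 | f (x t) = c].
    exact: (measurable_coord a0 t [set a | f a = c]).
  have := law1 _ _ setT mD mE measurableT.
  under eq_integral do rewrite kY1 mule1.
  rewrite kXE // (_ : _ `&` [set x : paths a0 | _] = set0) ?measure0; last first.
    by apply/seteqP; split=> // x [].
  move=> <-; congr (P _).
  by apply/seteqP; split=> w /=; rewrite /map_paths; tauto.
have NY0 : P NY = 0%E.
  apply: (@paths_neq_null _ _ R P C c0 (G \o Y1) fst (measurableT_comp mG mY1) mfst) => t c.
  have mD : measurable [set z : paths c0 | z t <> c] by exact: (measurable_coord c0 t (~` [set c])).
  have mE : measurable [set x : paths b0 | g (x t) = c].
    exact: (measurable_coord b0 t [set a | g a = c]).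
  have := law1 _ setT _ mD measurableT mE.
  under eq_integral do rewrite kX1 mul1e.
  rewrite kYE // (_ : _ `&` [set x : paths b0 | _] = set0) ?measure0; last first.
    by apply/seteqP; split=> // x [].
  move=> <-; congr (P _).
  by apply/seteqP; split=> w /=; rewrite /map_paths; tauto.
pose N := NX `|` NY; have mN : measurable N by exact: measurableU.
have N0 : P N = 0%E by rewrite measureU0.
have [w0 w0N] : exists w0, ~ N w0.
  apply: contrapT => /forallNP h; have := probability_setT P.
  rewrite (_ : setT = N) ?N0; last by apply/seteqP; split=> // w _; exact: contrapT (h w).
  by move=> /eqP; rewrite eqe eq_sym oner_eq0.
pose good (w : T) : T := if w \in N then w0 else w.
have goodN w : ~ N (good w) by rewrite /good; case: ifPn => [_ //|]; rewrite notin_setE.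
have mgood : measurable_fun [set: T] good.
  move=> _ V mV; rewrite setTI.
  rewrite (_ : good @^-1` V = (N `&` (if w0 \in V then setT else set0)) `|` (~` N `&` V)).
    apply: measurableU; apply: measurableI => //; first by case: ifP.
    exact: measurableC.
  apply/seteqP; split=> w /=; rewrite /good.
    case: ifPn => [/set_mem wN w0V|]; first by left; split=> //; rewrite mem_set.
    by rewrite notin_setE; right.
  move=> h; case: ifPn => [/set_mem wN|/negP nwN].
    by case: h => [[_]|[//]]; case: ifPn => // /set_mem.
  by case: h => [[wN _]|[_ //]]; case: nwN; rewrite inE.
exists _, T, P, (X1 \o good), (Y1 \o good), kX, kY; split=> //.
- exact: measurableT_comp.
- exact: measurableT_comp.
- move=> w /=; have := goodN w; rewrite /N /NX /NY /= => /not_orP[/contrapT -> /contrapT ->] //.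
move=> D E E' mD mE mE'; rewrite -law1 //.
have mV : measurable (F @^-1` D) by rewrite -[V in measurable V]setTI; exact: mF.
have mgI V : measurable V -> measurable (good @^-1` V).
  by move=> ?; rewrite -[W in measurable W]setTI; exact: mgood.
apply: (measure_eq_off_null mN) => //.
- apply: measurableI; first by apply: mgI (mX1I _ mV).
  by apply: measurableI; [exact: (mgI _ (mX1I _ mE))|exact: (mgI _ (mY1I _ mE'))].
- apply: measurableI; first exact: measurableX.
  by apply: measurableI; [exact: mX1I|exact: mY1I].
apply/seteqP; split=> w [] /= + nwN; rewrite /good memNset //;
have : F (X1 w) = w.1 by apply: contrapT => h; apply: nwN; left.
  by move=> -> [].
by move=> -> [[]].
Qed.

End coupling.

(** * Markov coupling of two chains with the same image *)

Lemma markov_chain_law (R : realType) (S : countType) (s0 : S) d (T : measurableType d)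
    (P : probability T R) mu p (X : nat -> T -> S) (hX : markov_chain P mu p X)
    (mX : measurable_fun [set: T] (trajectory X : T -> paths s0)) :
  (forall t a b, 0 <= p t a b) /\ markov_law (path_law P mX) p.
Proof.
split=> [t a b|s a b]; first by have [_ _ sp _ _] := hX; have [h _] := sp t a; exact: h.
pose x := nth a (rcons s a).
have xs : mkseq x (size s).+1 = rcons s a by rewrite -(size_rcons s a) mkseq_nth.
have hxs : history X x (size s) = trajectory X @^-1` cylinder s0 (rcons s a).
  by rewrite (@history_cylinder _ s0) xs.
have := markov_chain_transition hX (size s) x b.
rewrite hxs {1}/x nth_rcons ltnn eqxx !path_lawE => <-.
congr (P _); rewrite [cylinder s0 (rcons (rcons s a) b)]cylinder_rcons preimage_setI size_rcons.
by [].
Qed.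

(** Composing a kernel with the process produces a function that is measurable with
   respect to the sigma-algebra of the process, as a version of the conditional
   probability has to be. *)
Lemma cond_prob_of_kernel d (T : measurableType d) (R : realType) (P : probability T R)
    (C : countType) (c0 : C) (Z : nat -> T -> C)
    (mZ : measurable_fun [set: T] (trajectory Z : T -> paths c0))
    (k : paths c0 -> \bar R) (E : set T) :
  measurable_fun [set: paths c0] k -> (forall z, 0 <= k z <= 1)%E ->
  (forall D : set (paths c0), measurable D ->
    \int[path_law P mZ]_(z in D) k z = P (E `&` trajectory Z @^-1` D))%E ->
  is_cond_prob P (sigma_process Z) E (fun w => fine (k (trajectory Z w))).
Proof.
move=> mk k01 kE; have k0 z : (0 <= k z)%E by case/andP: (k01 z).
have kfin z : k z \is a fin_num.
  by rewrite ge0_fin_numE // (le_lt_trans _ (ltry 1)) //; case/andP: (k01 z).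
have mfk : measurable_fun [set: paths c0] (fun z => fine (k z)) by exact: measurableT_comp.
have mfkT : measurable_fun [set: T] (fun w => fine (k (trajectory Z w))).
  exact: (measurableT_comp mfk mZ).
split.
- move=> _ V mV; rewrite setTI; apply: sub_sigma_algebra.
  exists ((fun z : paths c0 => fine (k z)) @^-1` V); last by rewrite setTI.
  by have := mfk measurableT _ mV; rewrite setTI.
- apply: (@le_integrable _ _ _ P setT measurableT _ (cst 1%E)) => //.
  + exact/measurable_EFinP.
  + move=> w _; rewrite /= ger0_norm ?fine_ge0 // normr1 fineK //.
    by case/andP: (k01 (trajectory Z w)).
  + exact: (finite_measure_integrable_cst P 1).
move=> D [D' mD' <-]; rewrite setTI -kE //.
rewrite (integral_image_on P measurableT mZ) // setTI.
by apply: eq_integral => w _; rewrite fineK.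
Qed.

Theorem corollary2 (R : realType) (A B C : countType)
  (dX : measure_display) (TX : measurableType dX) (PX : probability TX R)
  (muX : A -> R) (pX : nat -> A -> A -> R) (Xbar : nat -> TX -> A)
  (dY : measure_display) (TY : measurableType dY) (PY : probability TY R)
  (muY : B -> R) (pY : nat -> B -> B -> R) (Ybar : nat -> TY -> B)
  (dZ : measure_display) (TZ : measurableType dZ) (PZ : probability TZ R)
  (muZ : C -> R) (pZ : nat -> C -> C -> R) (Zbar : nat -> TZ -> C)
  (f : A -> C) (g : B -> C)
  (hX : markov_chain PX muX pX Xbar)
  (hY : markov_chain PY muY pY Ybar)
  (hZ : markov_chain PZ muZ pZ Zbar)
  (hfX : eq_in_law PX (fun t w => f (Xbar t w)) PZ Zbar)
  (hgY : eq_in_law PZ Zbar PY (fun t w => g (Ybar t w))) :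
  exists (d : measure_display) (T : measurableType d) (P : probability T R)
    (mu : A * B -> R) (p : nat -> A * B -> A * B -> R)
    (X : nat -> T -> A) (Y : nat -> T -> B),
    markov_chain P mu p (fun t w => (X t w, Y t w)) /\
    eq_in_law P X PX Xbar /\
    eq_in_law P Y PY Ybar /\
    (forall (t : nat) (w : T), f (X t w) = g (Y t w)) /\
    cond_independent P X Y (fun t w => f (X t w)).
Proof.
pose a0 := Xbar 0%N point; pose b0 := Ybar 0%N point; pose c0 := Zbar 0%N point.
have mXbar : measurable_fun [set: TX] (trajectory Xbar : TX -> paths a0).
  by apply: measurable_trajectory; case: hX.
have mYbar : measurable_fun [set: TY] (trajectory Ybar : TY -> paths b0).
  by apply: measurable_trajectory; case: hY.
have mZbar : measurable_fun [set: TZ] (trajectory Zbar : TZ -> paths c0).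
  by apply: measurable_trajectory; case: hZ.
pose mX : probability (paths a0) R := path_law PX mXbar.
pose mY : probability (paths b0) R := path_law PY mYbar.
pose mZ : probability (paths c0) R := path_law PZ mZbar.
have mXE E : mX E = PX (trajectory Xbar @^-1` E) by exact: path_lawE.
have mYE E : mY E = PY (trajectory Ybar @^-1` E) by exact: path_lawE.
have mZE E : mZ E = PZ (trajectory Zbar @^-1` E) by exact: path_lawE.
have mZX D : measurable D -> mZ D = mX (map_paths c0 f @^-1` D).
  by move=> mD; rewrite mZE mXE; exact: esym (hfX _ mD).
have mZY D : measurable D -> mZ D = mY (map_paths c0 g @^-1` D).
  by move=> mD; rewrite mZE mYE; exact: (hgY _ mD).
have [pX0 markovX] : (forall t a b, 0 <= pX t a b) /\ markov_law mX pX :=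
  markov_chain_law hX mXbar.
have [pY0 markovY] : (forall t a b, 0 <= pY t a b) /\ markov_law mY pY :=
  markov_chain_law hY mYbar.
have [pZ0 markovZ] : (forall t a b, 0 <= pZ t a b) /\ markov_law mZ pZ :=
  markov_chain_law hZ mZbar.
have [d [T [P [X [Y [kX [kY [mTX mTY XY [kXP kYP] law]]]]]]]] := conditional_coupling mZX mZY.
clearbody mX mY mZ.
have [mkX kX01 kX1 kXE] := kXP; have [mkY kY01 kY1 kYE] := kYP.
pose Xt t w := X w t; pose Yt t w := Y w t; pose Zt t w := f (Xt t w).
have mTZ : measurable_fun [set: T] (trajectory Zt : T -> paths c0).
  have mF : measurable_fun [set: paths a0] (map_paths c0 f : paths a0 -> paths c0).
    exact: measurable_map_paths.
  exact: (measurableT_comp mF mTX).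
have kX0 E z : measurable E -> (0 <= kX E z)%E by move=> mE; case/andP: (kX01 E z mE).
have kY0 E z : measurable E -> (0 <= kY E z)%E by move=> mE; case/andP: (kY01 E z mE).
have lawXY E E' : measurable E -> measurable E' ->
    P (X @^-1` E `&` Y @^-1` E') = (\int[mZ]_z (kX E z * kY E' z))%E.
  by move=> mE mE'; rewrite -law // preimage_setT setTI.
have lawZ D : measurable D -> path_law P mTZ D = mZ D.
  move=> mD; rewrite path_lawE; have := law _ setT setT mD measurableT measurableT.
  under eq_integral do rewrite kX1 kY1 mul1e.
  by rewrite integral_cst // mul1e !preimage_setT !setIT => <-.
pose XYt t w := (Xt t w, Yt t w).
have coordX t a : measurable (Xt t @^-1` [set a]).
  by have := mTX measurableT _ (measurable_coord a0 t [set a]); rewrite setTI.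
have coordY t b : measurable (Yt t @^-1` [set b]).
  by have := mTY measurableT _ (measurable_coord b0 t [set b]); rewrite setTI.
have pXY : is_process XYt.
  apply: countable_process => t [a b].
  have -> : XYt t @^-1` [set (a, b)] = Xt t @^-1` [set a] `&` Yt t @^-1` [set b].
    by apply/seteqP; split=> w; rewrite /XYt /=; [move=> [-> ->]|move=> [-> ->]].
  exact: measurableI.
have [H HE] := joint_prefix_factor pX0 pY0 pZ0 markovX markovY markovZ mZX mZY
  (fun s => mkX _ (measurable_cylinder a0 s)) (fun s => mkY _ (measurable_cylinder b0 s))
  (fun s z => kX0 _ z (measurable_cylinder a0 s)) (fun s z => kY0 _ z (measurable_cylinder b0 s))
  (fun s D mD => kXE _ D (measurable_cylinder a0 s) mD)
  (fun s D mD => kYE _ D (measurable_cylinder b0 s) mD).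
pose J := joint_weight f g mX mY mZ.
have prefixE s a t b : size s = size t ->
    P (X @^-1` cylinder a0 (rcons s a) `&` Y @^-1` cylinder b0 (rcons t b)) =
    ((J s a t b)%:E * H (size s) a b)%E.
  by move=> st; rewrite lawXY ?HE //; exact: measurable_cylinder.
pose past1 (x : nat -> A * B) t := mkseq (fun i => (x i).1) t.
pose past2 (x : nat -> A * B) t := mkseq (fun i => (x i).2) t.
have sz x t : size (past1 x t) = size (past2 x t) by rewrite !size_mkseq.
have historyE x t : history XYt x t =
    X @^-1` cylinder a0 (rcons (past1 x t) (x t).1) `&`
    Y @^-1` cylinder b0 (rcons (past2 x t) (x t).2).
  rewrite -!mkseqS; have e1 := @history_cylinder _ a0 _ Xt (fun i => (x i).1) t.
  have e2 := @history_cylinder _ b0 _ Yt (fun i => (x i).2) t.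
  rewrite -[X @^-1` _]e1 -[Y @^-1` _]e2; apply/seteqP; split=> w.
    by move=> h; split=> i /h /= <-.
  by move=> [h1 h2] i it; rewrite /XYt (h1 i it) (h2 i it) -surjective_pairing.
have historyP x t : P (history XYt x t) =
    ((J (past1 x t) (x t).1 (past2 x t) (x t).2)%:E * H t (x t).1 (x t).2)%E.
  by rewrite historyE prefixE // size_mkseq.
have nextP x t a b : P (history XYt x t `&` XYt t.+1 @^-1` [set (a, b)]) =
    ((J (past1 x t) (x t).1 (past2 x t) (x t).2)%:E *
     ((joint_weight_step f g mX mY mZ pX pY pZ t (x t).1 (x t).2 a b)%:E * H t.+1 a b))%E.
  have -> : history XYt x t `&` XYt t.+1 @^-1` [set (a, b)] =
      X @^-1` cylinder a0 (rcons (rcons (past1 x t) (x t).1) a) `&`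
      Y @^-1` cylinder b0 (rcons (rcons (past2 x t) (x t).2) b).
    rewrite historyE [in RHS]cylinder_rcons [cylinder b0 (rcons (rcons _ _) _)]cylinder_rcons.
    rewrite !preimage_setI setIACA; congr (_ `&` _).
    rewrite !size_rcons !size_mkseq; apply/seteqP; split=> w; rewrite /XYt /Xt /Yt /=.
      by move=> [-> ->].
    by move=> [-> ->].
  rewrite prefixE ?size_rcons ?sz // muleA -EFinM size_mkseq; congr (_%:E * _)%E.
  by rewrite /J (joint_weight_rcons f g markovX markovY markovZ) // size_mkseq.
have [mu [p XYmarkov]] : exists mu p, markov_chain P mu p XYt.
  apply: markov_chain_of_histories => // t x y [a b] xy.
  by rewrite !historyP !nextP xy muleACA [RHS]muleACA; congr (_ * _)%E; exact: muleC.
exists d, T, P, mu, p, Xt, Yt; split=> //; split; last split; last split.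
- move=> E mE; rewrite /process_law -mXE.
  have := lawXY E setT mE measurableT.
  under eq_integral do rewrite kY1 mule1.
  by rewrite kXE // !preimage_setT setIT setTI.
- move=> E mE; rewrite /process_law -mYE.
  have := lawXY setT E measurableT mE.
  under eq_integral do rewrite kX1 mul1e.
  by rewrite kYE // !preimage_setT !setTI.
- by move=> t w; have := congr1 (fun z => z t) (XY w).
move=> _ _ [E mE <-] [E' mE' <-]; rewrite !setTI.
pose kXY z := (kX E z * kY E' z)%E.
have kernel k V : measurable_fun [set: paths c0] k -> (forall z, 0 <= k z <= 1)%E ->
    (forall D, measurable D -> \int[mZ]_(z in D) k z =
      P ((map_paths c0 f \o X) @^-1` D `&` V))%E ->
    is_cond_prob P (sigma_process Zt) V (fun w => fine (k (trajectory Zt w))).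
  move=> mk k01 kE; apply: (@cond_prob_of_kernel _ _ R P C c0 Zt mTZ k V) => // D mD.
  rewrite setIC -kE //; apply: eq_measure_integral => W mW _; exact: lawZ.
exists (fun w => fine (kX E (trajectory Zt w))), (fun w => fine (kY E' (trajectory Zt w))),
  (fun w => fine (kXY (trajectory Zt w))); split.
(* A kernel for one chain is recovered from the joint law by leaving the other
   chain unconstrained. *)
- apply: kernel; [exact: mkX|by move=> z; exact: kX01|move=> D mD].
  have := law D E setT mD mE measurableT.
  under eq_integral do rewrite kY1 mule1.
  by rewrite preimage_setT setIT => <-.
- apply: kernel; [exact: mkY|by move=> z; exact: kY01|move=> D mD].
  have := law D setT E' mD measurableT mE'.
  under eq_integral do rewrite kX1 mul1e.
  by rewrite preimage_setT setTI => <-.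
- apply: kernel; first by apply: emeasurable_funM; [exact: mkX|exact: mkY].
    move=> z; have /andP[x0 x1] := kX01 E z mE; have /andP[y0 y1] := kY01 E' z mE'.
    by rewrite mule_ge0 //= -[leRHS]mule1 lee_pmul.
  by move=> D mD; rewrite law.
apply: aeW => w; rewrite /kXY fineM //;
  rewrite ge0_fin_numE ?kX0 ?kY0 // (le_lt_trans _ (ltry 1)) //.
  by case/andP: (kX01 E (trajectory Zt w) mE).
by case/andP: (kY01 E' (trajectory Zt w) mE').
Qed.
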